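(* Let $(W,T)$ be a finite dual Coxeter system of rank $n$ and let $w\in W$. If $w$ is a quasi-Coxeter element for $(W,T)$, then for each $(t_1,\dots,t_n)\in\mathrm{Red}_T(w)$ one has $W=\langle t_1,\dots,t_n\rangle$.
   Context: A dual Coxeter system $(W,T)$ of (finite) rank $n$ consists of a group $W$ and a subset $T\subseteq W$ such that there is a subset $S\subseteq T$ with $|S|=n$, $(W,S)$ a Coxeter system, and $T=\{wsw^{-1}\mid w\in W, s\in S\}$; it is finite if $W$ is finite. Elements of $T$ are called reflections. For $w\in W$, $\mathrm{Red}_T(w)$ denotes the set of all tuples $(t_1,\dots,t_m)\in T^m$ with $w=t_1\cdots t_m$ and $m$ minimal. An element $w\in W$ is a quasi-Coxeter element for $(W,T)$ if there exists $(t_1,\dots,t_n)\in\mathrm{Red}_T(w)$ (with $n$ the rank) such that $W=\langle t_1,\dots,t_n\rangle$. *)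

(* Defs.v *)
From HB Require Import structures.
From mathcomp Require Import all_boot all_fingroup.

Set Implicit Arguments.
Unset Strict Implicit.
Unset Printing Implicit Defensive.

Local Open Scope group_scope.

(* (W, S) is a Coxeter system, for W finite (Bourbaki, Lie IV, §1.3): S is a
   generating set of involutions, and the relations (s s')^m(s,s') = 1, where
   m(s,s') is the order of s s' (always finite here), present W.  The latter is
   the universal property of the presentation; the target G is an arbitrary,
   possibly infinite, group. *)
Definition coxeter_system (gT : finGroupType) (W : {group gT}) (S : {set gT})
    : Prop :=
  [/\ <<S>> = W :> {set gT},
      forall s, s \in S -> #[s] = 2 &
      forall (G : groupType) (f : gT -> G),
        (forall s s', s \in S -> s' \in S ->
           (f s * f s') ^+ #[s * s'] = 1) ->
        exists g : gT -> G,
          (forall x y, x \in W -> y \in W -> g (x * y) = g x * g y) /\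
          (forall s, s \in S -> g s = f s)].

Definition dual_coxeter_system (gT : finGroupType) (n : nat) (W : {group gT})
    (T : {set gT}) : Prop :=
  T \subset W /\
  exists S : {set gT},
    [/\ S \subset T, #|S| = n, coxeter_system W S &
        T = [set w * s * w^-1 | w in W, s in S]].

Definition factorization (gT : finGroupType) (T : {set gT}) (w : gT)
    (m : nat) (t : m.-tuple gT) : Prop :=
  (forall i, tnth t i \in T) /\ \prod_(i < m) tnth t i = w.

(* t is an element of Red_T(w). *)
Definition Red (gT : finGroupType) (T : {set gT}) (w : gT)
    (m : nat) (t : m.-tuple gT) : Prop :=
  factorization T w t /\
  forall (k : nat) (u : k.-tuple gT), factorization T w u -> m <= k.

Definition quasi_coxeter (gT : finGroupType) (n : nat) (W : {group gT})
    (T : {set gT}) (w : gT) : Prop :=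
  exists t : n.-tuple gT, Red T w t /\ W = <<[set x in t]>> :> {set gT}.

(* Main.v *)
Require Import Defs.
From HB Require Import structures.
From mathcomp Require Import all_boot all_order all_fingroup all_algebra cyclic.
From mathcomp Require Import ring lra zify.
From Stdlib Require Rtrigo1 Rtrigo_calc.
From mathcomp Require Import Rstruct.

(* Both factorizations are read in a geometric representation: if the rows of
   [P] are roots of reflections with product [w], and [B] is the Gram matrix of
   the simple roots, then [det (1 - w) = det B * (det P)^2].

   Suppose first that all orders [m(s, s')] are at most 5.  Then the
   representation is defined over [O = Z[sqrt 2, tau]], [tau] the golden ratio.
   If the reflections of the rows of [P] generate [W], the rows span the root
   lattice over [O], so [det P] is a unit; by the determinant formula the same
   holds for the rows of [P'], where [P'] belongs to the other factorization.
   The inner product [c] of two roots has all its conjugates in [-2, 2], which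
   leaves 11 possible values.  Writing a root [v] (or [tau v]) as a sum of [k]
   vectors [m g] with [m] in [{1, sqrt 2, tau, sqrt 2 tau}] and [g] a root of
   the subgroup [W'] generated by the second factorization, some term pairs with
   it to an element of [O] with positive coefficient of 1; subtracting this term
   leaves [u] or [tau u] for a root [u], a sum of [k - 1] such vectors, and [v]
   is obtained from [u] and [g] by reflections.  So every root of [W] is a root
   of [W'], and Tits' theorem on the positivity of roots gives [W' = W].

   If [m(s, s') >= 6] for some [s], [s'], then [s] and [s'] commute with all
   other simple reflections, as otherwise two roots have inner product at most
   -2 and [W] is infinite.  So [W] splits off a dihedral factor, where the
   statement is elementary. *)

Set Implicit Arguments.
Unset Strict Implicit.
Unset Printing Implicit Defensive.

Import Order.TTheory GRing.Theory Num.Theory.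

(** * Generation by reflections *)

Section CoxeterGroups.
Local Open Scope group_scope.

Definition reflections (gT : finGroupType) (W S : {set gT}) : {set gT} :=
  [set w * s * w^-1 | w in W, s in S].

Lemma gen_ind (gT : finGroupType) (A : {set gT}) (P : gT -> Prop) :
    P 1 -> (forall a x, a \in A -> x \in <<A>> -> P x -> P (a * x)) ->
  forall x, x \in <<A>> -> P x.
Proof.
move=> P1 PM x /gen_prodgP[k [c cA ->]].
have: P (\prod_(i < k) c i) /\ \prod_(i < k) c i \in <<A>>; last by case.
elim: k c cA => [|k IHk] c cA; first by rewrite big_ord0 group1.
rewrite big_ord_recl; have [//|Pk gk] := IHk (fun i => c (lift ord0 i)).
by split; [apply: PM | rewrite groupM // mem_gen].
Qed.

Lemma subset_gen_ind (gT : finGroupType) (G : {group gT}) (A : {set gT})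
    (P : gT -> Prop) :
    G :=: <<A>> ->
    P 1 -> (forall a x, a \in A -> x \in G -> P x -> P (a * x)) ->
  forall x, x \in G -> P x.
Proof. by move=> ->; apply: gen_ind. Qed.

Lemma prod_inv_expg (gT : finGroupType) (a b : gT) k :
  a * a = 1 -> b * b = 1 -> (a * b) ^- k * a = a * (a * b) ^+ k.
Proof.
move=> aa bb; have xV : (a * b)^-1 * a = a * (a * b).
  by rewrite invMg mulgKV mulgA aa mul1g (mulg1_eq bb).
elim: k => [|k IHk]; first by rewrite expg0 invg1 mul1g mulg1.
by rewrite expgS invMg -mulgA xV mulgA IHk -mulgA -expgSr expgS.
Qed.

Lemma reflectionsP (gT : finGroupType) (W : {group gT}) (S : {set gT}) t :
  reflect (exists w s, [/\ w \in W, s \in S & t = s ^ w])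
          (t \in reflections W S).
Proof.
apply: (iffP imset2P) => [[w s wW sS ->]|[w [s [wW sS ->]]]].
  by exists w^-1, s; rewrite groupV /conjg invgK mulgA.
by exists w^-1 s; rewrite ?groupV // invgK conjgE mulgA.
Qed.

Lemma reflections_sub (gT : finGroupType) (W : {group gT}) (S : {set gT}) :
  S \subset W -> reflections W S \subset W.
Proof.
move=> /subsetP sSW; apply/subsetP => t /reflectionsP[w [s [wW sS ->]]].
exact: groupJ (sSW s sS) wW.
Qed.

Section System.
Variables (gT : finGroupType) (W : {group gT}) (S : {set gT}).
Hypothesis coxWS : coxeter_system W S.

Lemma cox_gen : W :=: <<S>>. Proof. by case: coxWS => ->. Qed.

Lemma cox_sub : S \subset W. Proof. by rewrite cox_gen subset_gen. Qed.

Lemma cox_mem s : s \in S -> s \in W. Proof. exact/subsetP/cox_sub. Qed.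

Lemma cox_inv s : s \in S -> s * s = 1.
Proof. by case: coxWS => _ o2 _ sS; rewrite -expg2 -(o2 s sS) expg_order. Qed.

Lemma refl_mem t : t \in reflections W S -> t \in W.
Proof. exact/subsetP/reflections_sub/cox_sub. Qed.

Lemma refl_inv t : t \in reflections W S -> t * t = 1.
Proof.
by case/reflectionsP=> w [s [_ sS ->]]; rewrite -conjMg cox_inv ?conj1g.
Qed.

Lemma cox_hom (G : groupType) (f : gT -> G) :
    (forall s s', s \in S -> s' \in S -> (f s * f s') ^+ #[s * s'] = 1) ->
  exists g : gT -> G,
    [/\ forall x y, x \in W -> y \in W -> g (x * y) = g x * g y,
        forall s, s \in S -> g s = f s & g 1 = 1].
Proof.
case: coxWS => _ _ univ /univ[g [gM gS]]; exists g; split=> //.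
by apply: (mulgI (g 1)); rewrite -gM // !mulg1.
Qed.

Lemma hom_inv (G : groupType) (g : gT -> G) x :
    (forall x y, x \in W -> y \in W -> g (x * y) = g x * g y) -> g 1 = 1 ->
  x \in W -> g x^-1 = (g x)^-1.
Proof.
by move=> gM g1 xW; apply: (mulgI (g x)); rewrite -gM ?groupV // !mulgV g1.
Qed.

Lemma hom_gen_trivial (G : groupType) (g : gT -> G) (A : {set gT}) :
    (forall x y, x \in W -> y \in W -> g (x * y) = g x * g y) -> g 1 = 1 ->
    W :=: <<A>> -> (forall a, a \in A -> g a = 1) ->
  forall x, x \in W -> g x = 1.
Proof.
move=> gM g1 defW gA x xW; move: x xW; apply: (subset_gen_ind defW) => //.
move=> a x aA xW gx; rewrite gM //; last by rewrite defW mem_gen.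
by rewrite gA // gx mulg1.
Qed.

(* A simple reflection conjugate to no element of [A] would be sent to [-1] by
   a character of [W] that is trivial on [A]. *)
Lemma simple_conj_generator (A : {set gT}) s :
    A \subset reflections W S -> W :=: <<A>> -> s \in S ->
  exists t g, [/\ t \in A, g \in W & s = t ^ g].
Proof.
move=> /subsetP AT defW sS.
(* The group [{perm bool}] of order 2 serves as the group of signs, with [z] as [-1]. *)
pose z : {perm bool} := tperm true false.
have zz : z * z = 1 by rewrite -expg2; apply/permP => b; rewrite expg2 tperm2.
have z1 : z != 1.
  by apply/eqP => /permP/(_ true); rewrite tpermL perm1.
pose f x : {perm bool} := if x \in s ^: W then z else 1.
have fW x g : g \in W -> f (x ^ g) = f x by move=> gW; rewrite /f class_sym classGidl // class_sym.
have fM s1 s2 : s1 \in S -> s2 \in S -> (f s1 * f s2) ^+ #[s1 * s2] = 1.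
  move=> s1S s2S; have [-> | neq] := eqVneq (f s1) (f s2).
    by rewrite /f; case: ifP; rewrite ?zz ?mulg1 expg1n.
  suffices even_m : ~~ odd #[s1 * s2].
    have -> : f s1 * f s2 = z.
      by move: neq; rewrite /f; case: ifP; case: ifP; rewrite ?eqxx ?mulg1 ?mul1g.
    by rewrite -(odd_double_half #[s1 * s2]) (negPf even_m) add0n -mul2n expgM expg2 zz expg1n.
  apply: contra neq => odd_m; apply/eqP.
  set x := s1 * s2 in odd_m *.
  have xVk k : (x ^+ k)^-1 * s1 = s1 * x ^+ k by rewrite prod_inv_expg ?cox_inv.
  (* Since [s1] inverts [x], its conjugate by [x ^+ k] is [s1 * x ^+ k.*2]. When [k.*2 = #[x].+1]
     this is [s1 * x = s2]. *)
  have -> : s2 = s1 ^ (x ^+ (#[x].+1)./2).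
    rewrite conjgE mulgA xVk -mulgA -expgD addnn.
    have -> : (#[x].+1)./2.*2 = #[x].+1.
      by rewrite -[RHS]odd_double_half /= odd_m.
    by rewrite expgS expg_order mulg1 /x mulgA (cox_inv s1S) mul1g.
  by rewrite fW // groupX // groupM ?cox_mem.
have [g [gM gS g1]] := cox_hom fM.
have gs : g s = z by rewrite gS // /f class_refl.
have [t tA ts] : exists2 t, t \in A & t \in s ^: W.
  case: (pickP [pred t in A | t \in s ^: W]) => [t /andP[tA ts]|no]; first by exists t.
  case/eqP: z1; rewrite -gs; apply: (hom_gen_trivial gM g1 defW) (cox_mem sS) => t tA.
  have /reflectionsP[w [r [wW rS def_t]]] := AT t tA.
  have wrW := groupJ (cox_mem rS) wW.
  have rW := cox_mem rS.
  rewrite def_t conjgE !gM ?groupM ?groupV // hom_inv // (gS r rS).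
  have -> : f r = 1.
    by rewrite -(fW r w wW) -def_t /f; have := no t; rewrite /= tA /= => ->.
  by rewrite mul1g mulVg.
move: ts; rewrite class_sym => /imsetP[h hW ->].
by exists t, h.
Qed.

(* By parity [t3] is not in [<[t1 * t2]>], so it is in the other coset of this
   subgroup, that of [t1]. *)
Lemma dihedral_generation t1 t2 t3 t4 :
    [set t1; t2; t3; t4] \subset reflections W S ->
    W :=: <<[set t1; t2]>> -> t1 * t2 = t3 * t4 ->
  W :=: <<[set t3; t4]>>.
Proof.
move=> /subsetP TT defW eq12.
pose z : {perm bool} := tperm true false.
have zz : z * z = 1 by rewrite -expg2; apply/permP => b; rewrite expg2 tperm2.
have z1 : z != 1.
  by apply/eqP => /permP/(_ true); rewrite tpermL perm1.
(* [g] is the sign character, which sends every reflection to [z]. *)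
have [|g [gM gS g1]] := @cox_hom _ (fun=> z).
  by move=> s1 s2 _ _; rewrite zz expg1n.
have g1z x : x \in W -> g x = 1 \/ g x = z.
  move: x; apply: (subset_gen_ind cox_gen); first by left.
  move=> s x sS xW gx; rewrite gM ?(gS s sS) ?(cox_mem sS) //.
  by case: gx => ->; [right; rewrite mulg1 | left].
have gT1 t : t \in reflections W S -> g t = z.
  case/reflectionsP=> w [s [wW sS ->]].
  have sW := cox_mem sS.
  rewrite conjgE !gM ?groupM ?groupV // hom_inv // (gS s sS).
  by case: (g1z w wW) => ->; rewrite ?invg1 ?mulg1 ?mul1g ?mulVg ?mulKg.
have t1T : t1 \in reflections W S by rewrite TT // !inE eqxx.
have t2T : t2 \in reflections W S by rewrite TT // !inE eqxx ?orbT.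
have t3T : t3 \in reflections W S by rewrite TT // !inE eqxx ?orbT.
have t4T : t4 \in reflections W S by rewrite TT // !inE eqxx ?orbT.
set x := t1 * t2 in eq12 *.
have xW : x \in W by rewrite groupM ?refl_mem.
have gx : g x = 1 by rewrite gM ?refl_mem // !gT1.
have xJ y : y \in <[x]> -> y ^ t1 \in <[x]>.
  case/cycleP=> k ->; rewrite conjXg groupX //.
  have := prod_inv_expg 1 (refl_inv t1T) (refl_inv t2T).
  rewrite !expg1 -/x => xV; suffices -> : x ^ t1 = x^-1 by rewrite groupV cycle_id.
  by rewrite conjgE mulgA (mulg1_eq (refl_inv t1T)) -xV -mulgA refl_inv ?mulg1.
(* [t1] normalizes [<[x]>], and [t2 = t1 * x] lies in the coset of [t1], so the cosets of [1] and
   [t1] cover [W]. *)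
have cyc y : y \in W -> y \in <[x]> \/ y * t1 \in <[x]>.
  have step u : u \in <[x]> \/ u * t1 \in <[x]> ->
      t1 * u \in <[x]> \/ t1 * u * t1 \in <[x]>.
    have t1V := mulg1_eq (refl_inv t1T).
    case=> /xJ; rewrite conjgE t1V; first by right; rewrite -mulgA.
    by move=> H; left; rewrite -[t1 * u]mulg1 -(refl_inv t1T) !mulgA; rewrite !mulgA in H.
  move: y; apply: (subset_gen_ind defW); first by left; apply: group1.
  move=> a y; rewrite !inE => /orP[] /eqP -> yW yC; first exact: step.
  have -> : t2 = t1 * x by rewrite mulgA refl_inv ?mul1g.
  rewrite -[t1 * x * y]mulgA; apply: step.
  by case: yC => yC; [left | right; rewrite -mulgA]; rewrite groupMl ?cycle_id.
have gC y : y \in <[x]> -> g y = 1.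
  case/cycleP=> k ->; elim: k => [|k IHk]; first by rewrite expg0.
  by rewrite expgS gM ?groupX // gx IHk mulg1.
have W'3 : t3 \in <<[set t3; t4]>> by rewrite mem_gen // !inE eqxx.
have W'x : x \in <<[set t3; t4]>>.
  by rewrite eq12 groupM // mem_gen // !inE eqxx ?orbT.
have W'1 : t1 \in <<[set t3; t4]>>.
  case: (cyc _ (refl_mem t3T)) => [/gC|].
    by rewrite gT1 // => /eqP; rewrite (negPf z1).
  have /subsetP sub : <[x]> \subset <<[set t3; t4]>> by rewrite cycle_subG.
  by move/sub; rewrite groupMl.
apply/eqP; rewrite eqEsubset; apply/andP; split.
  rewrite defW gen_subG; apply/subsetP => y; rewrite !inE => /orP[] /eqP -> //.
  by rewrite -(groupMl _ W'1).
by rewrite gen_subG; apply/subsetP => y; rewrite !inE => /orP[] /eqP ->; apply: refl_mem.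
Qed.




End System.
End CoxeterGroups.

(** * Word length and alternating words *)

Section WordLength.
Local Open Scope group_scope.
Variables (gT : finGroupType) (S : {set gT}).

(** Exactly [k] factors are taken, not at most [k]; the length is the least such [k]. *)
Fixpoint word_ball (k : nat) : {set gT} :=
  if k is k1.+1 then S * word_ball k1 else [1].

(** The second disjunct makes the search for a least [k] succeed outside [<<S>>] too, so that the
    length is a total function. *)
Lemma word_ball_exists x : exists k, (x \in word_ball k) || (x \notin <<S>>).
Proof.
have [xS | _] := boolP (x \in <<S>>); last by exists 0%N; rewrite orbT.
suff [k xk] : exists k, x \in word_ball k by exists k; rewrite xk.
move: x xS; apply: gen_ind => [|a x aS _ [k xk]]; first by exists 0%N; rewrite inE.
by exists k.+1; apply: mem_mulg.
Qed.

(* Junk value [0] outside [<<S>>]. *)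
Definition word_length x := ex_minn (word_ball_exists x).

Lemma word_length_ball x : x \in <<S>> -> x \in word_ball (word_length x).
Proof. by move=> xS; rewrite /word_length; case: ex_minnP => k; rewrite xS orbF. Qed.

Lemma word_length_min x k : x \in word_ball k -> word_length x <= k.
Proof.
by move=> xk; rewrite /word_length; case: ex_minnP => l _; apply; rewrite xk.
Qed.

Lemma word_lengthM a x : a \in S -> x \in <<S>> -> word_length (a * x) <= (word_length x).+1.
Proof.
by move=> aS xS; apply: word_length_min; rewrite /= mem_mulg // word_length_ball.
Qed.

Lemma word_length_cons x : x \in <<S>> -> x != 1 ->
  exists a y, [/\ a \in S, y \in <<S>>, x = a * y & word_length y < word_length x].
Proof.
move=> xS x1; have := word_length_ball xS; case def_k: (word_length x) => [|k] /=.
  by rewrite inE (negPf x1).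
case/mulsgP=> a y aS yk def_x; exists a, y; split=> //.
  by rewrite -(groupMl _ (mem_gen aS)) -def_x.
by rewrite ltnS word_length_min.
Qed.

End WordLength.

Section AlternatingWords.
Local Open Scope group_scope.
Variables (gT : finGroupType).
Implicit Types a b : gT.

Fixpoint alt a b k : gT := if k is k1.+1 then a * alt b a k1 else 1.

Lemma alt_last a b k : alt a b k.+1 = alt a b k * (if odd k then b else a).
Proof.
elim: k a b => [|k IHk] a b; first by rewrite /= mulg1 mul1g.
by rewrite [LHS]/= -/(alt b a k.+1) IHk /= mulgA; case: (odd k).
Qed.

Lemma alt_add a b p q : alt a b (p + q) = alt a b p * (if odd p then alt b a q else alt a b q).
Proof.
elim: p a b => [|p IHp] a b; first by rewrite mul1g.
by rewrite addSn /= IHp mulgA; case: (odd p).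
Qed.

Lemma alt_inv a b k : a * a = 1 -> b * b = 1 ->
  (alt a b k)^-1 = if odd k then alt a b k else alt b a k.
Proof.
move=> aa bb; elim: k a b aa bb => [|k IHk] a b aa bb; first by rewrite /= invg1.
rewrite [in LHS]/= invMg IHk // (mulg1_eq aa) [odd k.+1]/= if_neg.
by rewrite [alt a b k.+1]alt_last [alt b a k.+1]alt_last; case: (odd k).
Qed.

Lemma alt_double a b k : alt a b k.*2 = (a * b) ^+ k.
Proof. by elim: k => //= k ->; rewrite expgS mulgA. Qed.

(** Braid relation: the second half of the trivial word with [k.*2] letters is [(alt b a k)^-1]. *)
Lemma alt_braid a b k : a * a = 1 -> b * b = 1 -> (a * b) ^+ k = 1 ->
  alt a b k = alt b a k.
Proof.
move=> aa bb; rewrite -alt_double -addnn alt_add => abk.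
by apply: (mulIg (alt b a k)^-1); rewrite mulgV alt_inv.
Qed.

End AlternatingWords.

Local Open Scope ring_scope.

(** * Reflection matrices *)

Section InvertiblePairs.
Variables (K : comNzRingType) (n : nat).

(** The general linear group over [K], the target for the universal property of the presentation.
    [K] carries no inverse operation, so a matrix is kept together with its inverse. *)
Definition inv_pair : Type :=
  {p : 'M[K]_n * 'M[K]_n | (p.1 *m p.2 == 1%:M) && (p.2 *m p.1 == 1%:M)}.

HB.instance Definition _ := Choice.on inv_pair.

Lemma inv_pairP (p : inv_pair) :
  (val p).1 *m (val p).2 = 1%:M /\ (val p).2 *m (val p).1 = 1%:M.
Proof. by case: p => p /= /andP[/eqP-> /eqP->]. Qed.

Definition mk_pair (A A' : 'M[K]_n) (AA' : A *m A' = 1%:M) (A'A : A' *m A = 1%:M)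
    : inv_pair.
Proof. by exists (A, A'); rewrite /= AA' A'A !eqxx. Defined.

Definition pair_mul (p q : inv_pair) : inv_pair.
Proof.
apply: (@mk_pair ((val p).1 *m (val q).1) ((val q).2 *m (val p).2)).
- by rewrite mulmxA -[_ *m _ *m (val q).2]mulmxA (inv_pairP q).1 mulmx1 (inv_pairP p).1.
- by rewrite mulmxA -[_ *m _ *m (val p).1]mulmxA (inv_pairP p).2 mulmx1 (inv_pairP q).2.
Defined.

Definition pair_inv (p : inv_pair) : inv_pair :=
  mk_pair (inv_pairP p).2 (inv_pairP p).1.

Definition pair_one : inv_pair := mk_pair (mulmx1 1%:M) (mulmx1 1%:M).

Fact pair_mulA : associative pair_mul.
Proof. by move=> p q r; apply: val_inj; rewrite /= !mulmxA. Qed.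
Fact pair_mul1 : left_id pair_one pair_mul.
Proof. by case=> [[A A'] AP]; apply: val_inj; rewrite /= mul1mx mulmx1. Qed.
Fact pair_mulr1 : right_id pair_one pair_mul.
Proof. by case=> [[A A'] AP]; apply: val_inj; rewrite /= mul1mx mulmx1. Qed.
Fact pair_mulV : left_inverse pair_one pair_inv pair_mul.
Proof. by move=> p; apply: val_inj; rewrite /= !(inv_pairP p).2. Qed.
Fact pair_mulrV : right_inverse pair_one pair_inv pair_mul.
Proof. by move=> p; apply: val_inj; rewrite /= !(inv_pairP p).1. Qed.

HB.instance Definition _ := isGroup.Build inv_pair
  pair_mulA pair_mul1 pair_mulr1 pair_mulV pair_mulrV.

Lemma val_pairX (p : inv_pair) k : (val (p ^+ k)%g).1 = (val p).1 ^+ k.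
Proof. by elim: k => // k IHk; rewrite expgS exprS /= IHk. Qed.

End InvertiblePairs.

(** Chebyshev polynomials of the second kind: for [y = 2 cos th], [cheb y k] is
    [sin (k th) / sin th]. If [th = 2 pi / m] with [m >= 3], the values at [m] and [m - 1] are [0]
    and [-1]. *)
Fixpoint cheb (K : pzRingType) (y : K) (k : nat) : K :=
  match k with
  | 0 => 0
  | k1.+1 => match k1 with 0 => 1 | k2.+1 => y * cheb y k1 - cheb y k2 end
  end.

Lemma chebSS (K : pzRingType) (y : K) k : cheb y k.+2 = y * cheb y k.+1 - cheb y k.
Proof. by []. Qed.

Lemma sqmxAl (K : comNzRingType) n a (A C : 'M[K]_n) : a *: (A * C) = (a *: A) * C.
Proof. exact: scalemxAl. Qed.

Lemma sqmxAr (K : comNzRingType) n a (A C : 'M[K]_n) : a *: (A * C) = A * (a *: C).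
Proof. exact: scalemxAr. Qed.

Section Reflections.
Variables (K : comNzRingType) (n : nat) (B : 'M[K]_n).
Hypothesis Bsym : B^T = B.
Implicit Types u v : 'rV[K]_n.

Definition form u v : K := (u *m B *m v^T) 0 0.
(** Matrices act on row vectors from the right. There is no division by the norm of [v], so this is
    a reflection only when [form v v = 2]. *)
Definition refl_mx v : 'M[K]_n := 1%:M - B *m v^T *m v.

Lemma formC u v : form u v = form v u.
Proof.
have tr: (u *m B *m v^T)^T = v *m B *m u^T by rewrite !trmx_mul trmxK Bsym mulmxA.
by rewrite /form -tr [RHS]mxE.
Qed.

Lemma formDl u u' v : form (u + u') v = form u v + form u' v.
Proof. by rewrite /form !mulmxDl mxE. Qed.
Lemma formZl a u v : form (a *: u) v = a * form u v.
Proof. by rewrite /form -!scalemxAl mxE. Qed.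
Lemma formNl u v : form (- u) v = - form u v.
Proof. by rewrite -scaleN1r formZl mulN1r. Qed.
Lemma formDr u v v' : form u (v + v') = form u v + form u v'.
Proof. by rewrite formC formDl formC (formC v'). Qed.
Lemma formZr a u v : form u (a *: v) = a * form u v.
Proof. by rewrite formC formZl formC. Qed.
Lemma formNr u v : form u (- v) = - form u v.
Proof. by rewrite formC formNl formC. Qed.

Lemma form_mx u v : u *m B *m v^T = (form u v)%:M.
Proof. exact: mx11_scalar. Qed.

Lemma mul_refl_mx u v : u *m refl_mx v = u - form u v *: v.
Proof. by rewrite mulmxBr mulmx1 !mulmxA form_mx mul_scalar_mx. Qed.

Lemma refl_mx_self v : form v v = 2 -> v *m refl_mx v = - v.
Proof. by move=> vv; rewrite mul_refl_mx vv; apply/rowP=> j; rewrite !mxE; ring. Qed.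

Lemma refl_mxK v : form v v = 2 -> refl_mx v *m refl_mx v = 1%:M.
Proof.
move=> vv; rewrite {1}/refl_mx mulmxBl mul1mx -[_ *m v *m _]mulmxA refl_mx_self //.
by rewrite mulmxN opprK /refl_mx subrK.
Qed.

Lemma form_refl u v w : form v v = 2 -> form (u *m refl_mx v) (w *m refl_mx v) = form u w.
Proof.
move=> vv; rewrite !mul_refl_mx -!scaleNr !formDl !formDr !formZl !formZr vv (formC v w).
ring.
Qed.

(* [M] has characteristic polynomial [X^2 - (c^2 - 2) X + 1] on the span of [v], [u]. *)
Lemma refl_mx_order v u m (c := form v u) (M := refl_mx v *m refl_mx u) :
    form v v = 2 -> form u u = 2 -> (forall a : K, (4 - c ^+ 2) * a = 0 -> a = 0) ->
    cheb (c ^+ 2 - 2) m.+1 = 0 -> cheb (c ^+ 2 - 2) m = -1 ->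
  M ^+ m.+1 = 1.
Proof.
move=> vv uu reg; set y := c ^+ 2 - 2; move=> ch0 ch1.
have vM : v *m M = - v + c *: u.
  by rewrite mulmxA (@refl_mx_self v) // mulNmx mul_refl_mx -/c opprB addrC.
have uM : u *m M = (c ^+ 2 - 1) *: u - c *: v.
  rewrite mulmxA (mul_refl_mx u v) (formC u v) -/c mulmxBl -scalemxAl refl_mx_self // mul_refl_mx -/c.
  by apply/rowP => j; rewrite !mxE; ring.
(* The rows of [N] lie in the span of [v] and [u], where the quadratic relation for [M] holds. *)
pose N := M - 1.
have defN : N = - (B *m v^T *m (v *m refl_mx u)) - B *m u^T *m u.
  have -> : N = refl_mx u - B *m v^T *m (v *m refl_mx u) - 1%:M.
    by rewrite /N /M {1}[refl_mx v]/refl_mx mulmxBl mul1mx !mulmxA.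
  by apply/matrixP => i j; rewrite /refl_mx !mxE; ring.
have quad u' : u' \in [:: v; u] -> u' *m (M ^+ 2 - y *: M + 1) = 0.
  rewrite !inE expr2 mulmxDr mulmxBr mulmx1 -scalemxAr [_ * _]/(_ *m _) mulmxA.
  case/orP=> /eqP->.
    by rewrite vM mulmxDl mulNmx -scalemxAl uM vM; apply/rowP => j; rewrite !mxE /y; ring.
  by rewrite uM mulmxBl -!scalemxAl uM vM; apply/rowP => j; rewrite !mxE /y; ring.
have Nquad : N * (M ^+ 2 - y *: M + 1) = 0.
  have quadr : v *m refl_mx u *m (M ^+ 2 - y *: M + 1) = 0.
    by rewrite mul_refl_mx mulmxBl -scalemxAl !quad ?inE ?eqxx ?orbT // scaler0 subr0.
  rewrite defN -[_ * _]/(_ *m _) mulmxBl mulNmx -[_ *m _ *m (M ^+ _ - _ + _)]mulmxA quadr.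
  by rewrite -[_ *m _ *m (M ^+ _ - _ + _)]mulmxA quad ?inE ?eqxx ?orbT // !mulmx0 oppr0 addr0.
have comMN : GRing.comm M N by rewrite /GRing.comm /N mulrBl mulrBr mulr1 mul1r.
have NM2 : N * M * M = y *: (N * M) - N.
  move: Nquad; rewrite mulrDr mulrBr mulr1 -sqmxAr expr2 mulrA => /eqP.
  by rewrite -addrA addr_eq0 opprD opprK => /eqP ->.
have NMk k : N * M ^+ k.+1 = cheb y k.+1 *: (N * M) - cheb y k *: N.
  elim: k => [|k IHk]; first by rewrite expr1 scale1r scale0r subr0.
  rewrite exprSr mulrA IHk mulrBl -!sqmxAl NM2 chebSS.
  by apply/matrixP => i j; rewrite !mxE; ring.
have NMm : N * M ^+ m.+1 = N by rewrite NMk ch0 ch1 scale0r scaleN1r opprK add0r.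
(* [2 - y] is [4 - c ^+ 2], which can be cancelled. Below it is written as a combination of the
   quadratic polynomial in [M] and of [N], and [M ^+ m.+1 - 1] kills both. *)
suffices reg0 : (2 - y) *: (M ^+ m.+1 - 1) = 0.
  apply/eqP; rewrite -subr_eq0; apply/eqP/matrixP => i j.
  have := congr1 (fun Z : 'M_n => Z i j) reg0; rewrite /= mxE [RHS]mxE => red0.
  by rewrite [RHS]mxE; apply: reg; rewrite -[RHS]red0 /y; ring.
set X := M ^+ m.+1 in NMm *.
have comX : GRing.comm X N by apply/commr_sym/commrX/commr_sym.
have X0 : (X - 1) * N = 0 by rewrite mulrBl mul1r comX NMm subrr.
have XQ : (X - 1) * (M ^+ 2 - y *: M + 1) = 0.
  rewrite /X subrX1 -/N.
  have comS : GRing.comm (\sum_(i < m.+1) M ^+ i) N.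
    by apply/commr_sym/commr_sum => i _; apply/commrX/commr_sym.
  by rewrite -comS -mulrA Nquad mulr0.
have fac : (2 - y)%:M = (M ^+ 2 - y *: M + 1) - N * (M + 1 - y%:M).
  have -> : N * (M + 1 - y%:M) = M ^+ 2 - 1 - y *: (M - 1).
    rewrite mulrBr [N * y%:M]mul_mx_scalar /N; congr (_ - _).
    by rewrite mulrDr mulr1 mulrBl mul1r -expr2 addrA subrK.
  by apply/matrixP => i j; rewrite !mxE; case: (i == j) => /=; ring.
by rewrite -mul_mx_scalar fac [LHS]mulrBr XQ mulrA X0 mul0r subrr.
Qed.

(** Reflections in orthogonal roots commute. The Chebyshev criterion does not cover this case: for
    [c = 0] it would need [cheb (- 2) 2 = 0], but the value is [- 2]. *)
Lemma refl_mx_order2 v u :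
  form v v = 2 -> form u u = 2 -> form v u = 0 -> (refl_mx v *m refl_mx u) ^+ 2 = 1.
Proof.
move=> vv uu vu0; have uv0 : form u v = 0 by rewrite formC.
have exp a b : form a b = 0 ->
    refl_mx a *m refl_mx b = 1%:M - B *m a^T *m a - B *m b^T *m b.
  move=> ab0; rewrite {1}/refl_mx mulmxBl mul1mx -[_ *m a *m _]mulmxA.
  rewrite (mul_refl_mx a b) ab0 scale0r subr0 /refl_mx.
  by apply/matrixP => i j; rewrite !mxE; ring.
have com : refl_mx v *m refl_mx u = refl_mx u *m refl_mx v.
  by rewrite !exp // addrAC.
rewrite expr2 -[_ * _]/(_ *m _) {2}com mulmxA -[_ *m _ *m refl_mx u]mulmxA.
by rewrite refl_mxK // mulmx1 refl_mxK.
Qed.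

Lemma refl_factor_step k v (P : 'M[K]_(k, n)) (L : 'M[K]_k) :
  1%:M - refl_mx v *m (1%:M - B *m P^T *m L *m P) =
  B *m (col_mx v P)^T *m block_mx 1%:M (- (v *m (B *m P^T *m L))) 0 L *m col_mx v P.
Proof.
rewrite tr_col_mx mul_mx_row mul_row_block mul_row_col.
rewrite mulmx0 addr0 mulmx1 mulmxN mulmxBr mulmx1 opprB /refl_mx !mulmxBl mul1mx.
rewrite !mulmxDl mulNmx !mulmxA.
by apply/matrixP => i j; rewrite !mxE; ring.
Qed.

(** Each further root borders [L] by a row and a column with [1] in the corner and zeros below, so
    [L] is upper unitriangular. For [k = n] this yields the determinant formula, for general [k] the
    bound [k] on the rank of [1 - w]. *)
Lemma refl_prod_factor k (P : 'M[K]_(k, n)) :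
  exists2 L : 'M[K]_k, \det L = 1 &
    1%:M - \prod_(i < k) refl_mx (row i P) = B *m P^T *m L *m P.
Proof.
elim: k P => [|k IHk] P.
  exists 1%:M; first exact: det1.
  by rewrite big_ord0 subrr [P]flatmx0 mulmx0.
have [L detL defL] := IHk (dsubmx (P : 'M_(1 + k, n))).
set v := row ord0 P; set P' := dsubmx _ in defL.
have defP : P = col_mx v P' :> 'M_(1 + k, n).
  rewrite -[LHS](@vsubmxK _ 1 k); congr col_mx; apply/rowP => j; rewrite !mxE.
  by congr (P _ _); apply/val_inj.
exists (block_mx 1%:M (- (v *m (B *m P'^T *m L))) 0 L).
  have := det_ublock (1%:M : 'M[K]_1) (- (v *m (B *m P'^T *m L))) L.
  by rewrite det1 mul1r detL.
rewrite big_ord_recl -/v.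
have -> : \prod_(i < k) refl_mx (row (lift ord0 i) P) = 1%:M - B *m P'^T *m L *m P'.
  rewrite -defL opprB addrC subrK; apply: eq_bigr => i _; congr refl_mx.
  by apply/rowP => j; rewrite !mxE; congr (P _ _); apply/val_inj.
rewrite defP; exact: refl_factor_step.
Qed.

End Reflections.

(** * Geometric representations *)

Section Representation.
Variables (gT : finGroupType) (W : {group gT}) (n : nat) (e : 'I_n -> gT).
Let S : {set gT} := [set e i | i in 'I_n].
Let T : {set gT} := reflections W S.

Section GenericRing.
Variables (K : comNzRingType) (B : 'M[K]_n).

(* [B] is twice the matrix of the Tits form; off the diagonal, [B i j] plays the
   role of [- 2 cos (pi / m)] where [m] is the order of [e i * e j]. *)
Definition coxeter_form :=
  [/\ B^T = B, forall i, B i i = 2 &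
      forall i j, i != j ->
        let m := #[e i * e j]%g in let y := B i j ^+ 2 - 2 in
        m = 2%N /\ B i j = 0 \/
        [/\ forall a : K, (4 - B i j ^+ 2) * a = 0 -> a = 0,
            cheb y m = 0 & cheb y m.-1 = -1]].

(** Bundles what is used of the representation and is preserved by base change along a ring
    morphism, see [map_geomrep]. *)
Definition geomrep (rho : gT -> 'M[K]_n) :=
  [/\ coxeter_system W S, B^T = B, forall i, B i i = 2 &
      [/\ forall x y, x \in W -> y \in W -> rho (x * y)%g = rho x *m rho y,
          forall i, rho (e i) = refl_mx B (delta_mx 0 i) & rho 1%g = 1%:M]].

Lemma form_delta (M : 'M[K]_n) i j : form M (delta_mx 0 i) (delta_mx 0 j) = M i j.
Proof. by rewrite /form -rowE trmx_delta -colE !mxE. Qed.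

Lemma S_e i : e i \in S. Proof. exact: imset_f. Qed.

(** [refl_mx_order] and [refl_mx_order2] are the Coxeter relations between the reflections in the
    basis vectors, so the universal property applies with target [inv_pair]. *)
Lemma geomrep_exists :
  coxeter_system W S -> injective e -> coxeter_form -> exists rho, geomrep rho.
Proof.
move=> coxWS e_inj [Bsym Bdiag Bcox].
have dd i : form B (delta_mx 0 i) (delta_mx 0 i) = 2 by rewrite form_delta.
pose r i := mk_pair (refl_mxK (dd i)) (refl_mxK (dd i)).
pose f x := if [pick i | e i == x] is Some i then r i else 1%g.
have fe i : f (e i) = r i.
  rewrite /f; case: pickP => [j /eqP/e_inj-> //|/(_ i)]; by rewrite eqxx.
have [|g [gM gS g1]] := @cox_hom _ _ _ coxWS _ f.
  move=> _ _ /imsetP[i _ ->] /imsetP[j _ ->]; rewrite !fe.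
  have val1 (p : inv_pair K n) : (val p).1 = 1%:M -> p = 1%g.
    case: p => [[P P'] /=] PP P1; apply: val_inj => /=; move: PP; rewrite P1 /= mul1mx.
    by case/andP=> /eqP->.
  apply: val1; rewrite val_pairX /=.
  have [eq_ij | ij] := eqVneq i j.
    by rewrite -eq_ij refl_mxK // expr1n.
  have m_gt0 := order_gt0 (e i * e j)%g.
  have [[-> Bij]|[reg ch0 ch1]] := Bcox i j ij.
    by apply: refl_mx_order2; rewrite ?form_delta.
  rewrite -(prednK m_gt0); apply: refl_mx_order; rewrite ?form_delta ?prednK //.
exists (fun x => (val (g x)).1); split=> //; split=> [x y xW yW|i|]; last by rewrite g1.
- by rewrite gM.
- by rewrite gS ?S_e // fe.
Qed.

Section Rep.
Variable rho : gT -> 'M[K]_n.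
Hypothesis repr : geomrep rho.

Lemma rep_cox : coxeter_system W S. Proof. by case: repr. Qed.
Lemma rep_sym : B^T = B. Proof. by case: repr. Qed.
Lemma rep_diag i : B i i = 2. Proof. by case: repr. Qed.
Lemma repM x y : x \in W -> y \in W -> rho (x * y)%g = rho x *m rho y.
Proof. by case: repr => _ _ _ [h _ _]; apply: h. Qed.
Lemma rep1 : rho 1%g = 1%:M. Proof. by case: repr => _ _ _ []. Qed.
Lemma rep_e i : rho (e i) = refl_mx B (delta_mx 0 i).
Proof. by case: repr => _ _ _ []. Qed.

Lemma W_e i : e i \in W. Proof. exact/(cox_mem rep_cox)/S_e. Qed.

Lemma simple_norm i : form B (delta_mx 0 i) (delta_mx 0 i) = 2.
Proof. by rewrite form_delta rep_diag. Qed.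

Lemma repVr x : x \in W -> rho x *m rho x^-1%g = 1%:M.
Proof. by move=> xW; rewrite -repM ?groupV // mulgV rep1. Qed.
Lemma repVl x : x \in W -> rho x^-1%g *m rho x = 1%:M.
Proof. by move=> xW; rewrite -repM ?groupV // mulVg rep1. Qed.

Lemma form_rep x u v : x \in W -> form B (u *m rho x) (v *m rho x) = form B u v.
Proof.
move=> xW; move: x xW u v; apply: (subset_gen_ind (cox_gen rep_cox)) => [u v|a x aS xW IHx u v].
  by rewrite rep1 !mulmx1.
have /imsetP[i _ ->] := aS; rewrite repM ?W_e // !mulmxA IHx rep_e form_refl ?rep_sym //.
by rewrite form_delta rep_diag.
Qed.

Lemma rep_form x : x \in W -> B *m (rho x)^T = rho x^-1%g *m B.
Proof.
move=> xW; have BB : rho x *m B *m (rho x)^T = B.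
  apply/matrixP => i j; rewrite -[RHS]form_delta -(form_rep _ _ xW) -[LHS]form_delta.
  by rewrite /form !trmx_mul !mulmxA.
by rewrite -[in RHS]BB !mulmxA repVl // mul1mx.
Qed.

(** A root is carried together with its reflection: that [v] determines [t] rests on faithfulness,
    see [root_inj]. *)
Definition is_root (v : 'rV[K]_n) (t : gT) :=
  exists i x, [/\ x \in W, v = delta_mx 0 i *m rho x & t = (e i ^ x)%g].

Lemma root_norm v t : is_root v t -> form B v v = 2.
Proof. by case=> i [x [xW -> _]]; rewrite form_rep // form_delta rep_diag. Qed.

Lemma root_T v t : is_root v t -> t \in T.
Proof. by case=> i [x [xW _ ->]]; apply/reflectionsP; exists x, (e i); rewrite S_e. Qed.

Lemma root_W v t : is_root v t -> t \in W.
Proof. by move/root_T/(refl_mem rep_cox). Qed.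

Lemma T_root t : t \in T -> exists v, is_root v t.
Proof.
case/reflectionsP=> x [_ [xW /imsetP[i _ ->] ->]].
by exists (delta_mx 0 i *m rho x), i, x.
Qed.

Lemma root_rep v t : is_root v t -> rho t = refl_mx B v.
Proof.
case=> i [x [xW -> ->]]; rewrite conjgE !repM ?groupM ?groupV ?W_e // rep_e /refl_mx.
rewrite mulmxBl mulmxBr mul1mx repVl //; congr (_ - _).
by rewrite trmx_mul !mulmxA rep_form.
Qed.

Lemma root_e i : is_root (delta_mx 0 i) (e i).
Proof. by exists i, 1%g; rewrite group1 rep1 mulmx1 conjg1. Qed.

Lemma rootJ v t x : x \in W -> is_root v t -> is_root (v *m rho x) (t ^ x)%g.
Proof.
move=> xW [i [y [yW -> ->]]]; exists i, (y * x)%g.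
by rewrite groupM // repM // mulmxA conjgM.
Qed.

Lemma rootN v t : is_root v t -> is_root (- v) t.
Proof.
move=> r; have := rootJ (root_W r) r.
rewrite (root_rep r) refl_mx_self ?(root_norm r) //.
have tt := refl_inv rep_cox (root_T r).
by rewrite conjgE tt mulg1 (mulg1_eq tt).
Qed.

Lemma root_refl v t u s : is_root v t -> is_root u s ->
  is_root (v - form B v u *: u) (t ^ s)%g.
Proof.
move=> vt us; rewrite -mul_refl_mx -(root_rep us); apply: rootJ => //.
exact: root_W us.
Qed.

Lemma rep_prod k (t : 'I_k -> gT) : (forall i, t i \in W) ->
  rho (\prod_(i < k) t i)%g = \prod_(i < k) rho (t i).
Proof.
elim: k t => [|k IHk] t tW; first by rewrite !big_ord0 rep1.
by rewrite !big_ord_recl repM ?IHk // group_prod.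
Qed.

Definition root_rows k (P : 'M[K]_(k, n)) (t : 'I_k -> gT) :=
  forall i, is_root (row i P) (t i).

Lemma root_rows_exist k (t : 'I_k -> gT) : (forall i, t i \in T) -> exists P, root_rows P t.
Proof.
move=> tT; have [v vt] := fin_all_exists (fun i => T_root (tT i)).
by exists (\matrix_i v i) => i; rewrite rowK.
Qed.

Lemma root_rows_factor k (P : 'M[K]_(k, n)) (t : 'I_k -> gT) : root_rows P t ->
  exists2 L : 'M[K]_k, \det L = 1 &
    1%:M - rho (\prod_(i < k) t i)%g = B *m P^T *m L *m P.
Proof.
move=> Pt; have [L detL defL] := refl_prod_factor B P; exists L => //.
rewrite -defL rep_prod => [|i]; last exact: root_W (Pt i).
by congr (_ - _); apply: eq_bigr => i _; rewrite (root_rep (Pt i)).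
Qed.

Lemma root_rows_det (P : 'M[K]_n) (t : 'I_n -> gT) : root_rows P t ->
  \det (1%:M - rho (\prod_(i < n) t i)%g) = \det B * \det P ^+ 2.
Proof.
move=> /root_rows_factor[L detL ->].
by rewrite !det_mulmx det_tr detL mulr1 expr2 mulrA.
Qed.

(** The reflection in a row of [P] is the identity modulo multiples of this row, and being the
    identity modulo the row span of [P] is stable under products. *)
Lemma root_rows_span k (P : 'M[K]_(k, n)) (t : 'I_k -> gT) x : root_rows P t ->
  x \in <<[set t i | i in 'I_k]>>%g -> exists Z, rho x = 1%:M + Z *m P.
Proof.
move=> Pt; have sub : <<[set t i | i in 'I_k]>>%g \subset W.
  by rewrite gen_subG; apply/subsetP => _ /imsetP[i _ ->]; apply: root_W (Pt i).
move: x; apply: gen_ind => [|_ x /imsetP[i _ ->] xG [Z defZ]].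
  by exists 0; rewrite mul0mx addr0 rep1.
have xW := subsetP sub _ xG.
exists (Z - B *m (row i P)^T *m (delta_mx 0 i + row i P *m Z)).
rewrite repM // ?(root_W (Pt i)) // (root_rep (Pt i)) {1}/refl_mx defZ.
rewrite mulmxBl mul1mx mulmxBl -!mulmxA [(_ + row i P *m Z) *m P]mulmxDl -rowE.
by rewrite mulmxDr mulmx1 -!mulmxA addrA.
Qed.

End Rep.
End GenericRing.
End Representation.

(** * Real representations of finite Coxeter groups *)

Section RealRepresentation.
Variables (gT : finGroupType) (W : {group gT}) (n : nat) (e : 'I_n -> gT).
Let T : {set gT} := reflections W [set e i | i in 'I_n].
Variables (R : realFieldType) (B : 'M[R]_n) (rho : gT -> 'M[R]_n).
Hypothesis repr : geomrep W e B rho.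

Let coxWS := rep_cox repr.
Let Bsym := rep_sym repr.
Let Bdiag := rep_diag repr.
Let rhoM := repM repr.
Let We := W_e repr.

(** Reindexing the sum by left multiplication by [e i] negates its row [i]. *)
Lemma sum_rep0 : \sum_(x in W) rho x = 0.
Proof.
apply/row_matrixP => i; rewrite row0 rowE; set v := _ *m _.
suffices vN : v = - v.
  by move: v vN => v /rowP vN; apply/rowP => j; move: (vN j); rewrite !mxE; lra.
rewrite {1}/v (reindex_inj (mulgI (e i))) /= (eq_bigl (mem W)) => [|x]; last first.
  by rewrite /= groupMl.
rewrite (eq_bigr (fun x => rho (e i) *m rho x)) => [|x xW]; last by rewrite rhoM.
rewrite -mulmx_sumr mulmxA (rep_e repr) refl_mx_self ?form_delta //.
by rewrite mulNmx.
Qed.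

(** Here finiteness enters: a vector [v] in the radical of the form is fixed by [W], so [#|W|] times
    [v] is its image under the sum of all [rho x], which is [0]. *)
Lemma form_det_neq0 : \det B != 0.
Proof.
apply/det0P => -[v v0 vB]; case/eqP: v0.
have fix_v x : x \in W -> v *m rho x = v.
  move: x; apply: (subset_gen_ind (cox_gen coxWS)) => [|_ x /imsetP[i _ ->] xW IHx].
    by rewrite (rep1 repr) mulmx1.
  by rewrite rhoM // mulmxA (rep_e repr) mul_refl_mx /form vB mul0mx mxE scale0r subr0.
have : v *m (\sum_(x in W) rho x) = 0 by rewrite sum_rep0 mulmx0.
rewrite mulmx_sumr (eq_bigr (fun=> v)) ?sumr_const; last by move=> x; apply: fix_v.
by move/eqP; rewrite -scaler_nat scaler_eq0 pnatr_eq0 eqn0Ngt cardG_gt0 => /eqP.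
Qed.

Lemma generating_roots_full k (P : 'M[R]_(k, n)) (t : 'I_k -> gT) :
  root_rows W e rho P t -> W :=: <<[set t i | i in 'I_k]>>%g -> row_full P.
Proof.
move=> Pt defW; rewrite -sub1mx; apply/row_subP => i.
have [Z defZ] : exists Z, rho (e i) = 1%:M + Z *m P.
  by apply: (root_rows_span repr Pt); rewrite // -defW.
(* [e i] negates its own root, so [Z *m P] sends that root to [- 2] times itself; hence the root is
   in the row span of [P]. *)
have := refl_mx_self (simple_norm repr i).
rewrite -(rep_e repr) defZ mulmxDr mulmx1 mulmxA => eqZ.
rewrite row1; apply/submxP; exists (- (2^-1 *: (delta_mx 0 i *m Z))).
rewrite mulNmx -scalemxAl; move: (_ *m P) eqZ => u /rowP eqZ.
by apply/rowP => j; move: (eqZ j); rewrite !mxE; lra.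
Qed.

Lemma generating_size k (t : 'I_k -> gT) :
  (forall i, t i \in T) -> W :=: <<[set t i | i in 'I_k]>>%g -> (n <= k)%N.
Proof.
move=> tT defW; have [P Pt] := root_rows_exist rho tT.
by have := generating_roots_full Pt defW; rewrite /row_full => /eqP <-; apply: rank_leq_row.
Qed.

Lemma quasi_coxeter_det (t : 'I_n -> gT) :
    (forall i, t i \in T) -> W :=: <<[set t i | i in 'I_n]>>%g ->
  \det (1%:M - rho (\prod_(i < n) t i)%g) != 0.
Proof.
move=> tT defW; have [P Pt] := root_rows_exist rho tT.
rewrite (root_rows_det repr Pt) mulf_neq0 ?form_det_neq0 // expf_neq0 //.
by rewrite -unitfE -unitmxE -row_full_unit; apply: generating_roots_full Pt defW.
Qed.

(** For the product [w], the matrix of [1 - w] is invertible by the first factorization, while by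
    the second it factors through [k] rows. *)
Lemma quasi_coxeter_size k (t : 'I_n -> gT) (t' : 'I_k -> gT) :
    (forall i, t i \in T) -> (forall i, t' i \in T) -> W :=: <<[set t i | i in 'I_n]>>%g ->
    (\prod_(i < n) t i)%g = (\prod_(i < k) t' i)%g ->
  (n <= k)%N.
Proof.
move=> tT t'T defW eqt; have [P' Pt'] := root_rows_exist rho t'T.
have [L _ defL] := root_rows_factor repr Pt'.
have := quasi_coxeter_det tT defW; rewrite eqt -unitfE -unitmxE => /mxrank_unit <-.
by rewrite defL; apply: leq_trans (mxrankM_maxr _ _) (rank_leq_row _).
Qed.

(* If [c = - form a b >= 2], the coefficients of the iterates of [b] under the
   product of both reflections grow, unless [a] and [b] are proportional. *)
Lemma root_form_bound a b t s :
  is_root W e rho a t -> is_root W e rho b s -> form B a b <= - 2 -> a = - b.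
Proof.
move=> ra rb; set c := - form B a b => c2.
have fab : form B a b = - c by rewrite opprK.
have aa := root_norm repr ra.
have bb := root_norm repr rb.
have tW := root_W repr ra; have sW := root_W repr rb.
have growth k : exists p q, [/\ b *m rho ((t * s) ^+ k)%g = p *: a + q *: b,
    0 <= p, p + 1 <= q & 1 + 2 * k%:R <= q].
  elim: k => [|k [p [q [IH p0 pq kq]]]].
    exists 0, 1; split; rewrite ?mulr0 ?addr0 ?add0r //.
    by rewrite expg0 (rep1 repr) mulmx1 scale0r scale1r add0r.
  exists (c * q - p), (c * (c * q - p) - q).
  have cq : 2 * q <= c * q by rewrite ler_wpM2r //; lra.
  have cp : 2 * (c * q - p) <= c * (c * q - p) by rewrite ler_wpM2r //; lra.
  rewrite expgSr rhoM ?groupX ?groupM // mulmxA IH rhoM // mulmxA.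
  rewrite (root_rep repr ra) (root_rep repr rb).
  split; [|lra|lra|rewrite -addn1 natrD; lra].
  rewrite mulmxDl -!scalemxAl refl_mx_self // (mul_refl_mx B b a) (formC Bsym b a) fab.
  rewrite mulmxDl -!scalemxAl mulmxBl mulNmx -!scalemxAl refl_mx_self // (mul_refl_mx B a b) fab.
  by apply/rowP => j; rewrite !mxE; ring.
(* At the order of [t * s] the iterate is [b] again, so [(q - 1) b = - p a]. Comparing norms gives
   [q - 1 = p], and this is positive. *)
have [p [q [pq0 p0 pq kq]]] := growth #[t * s]%g.
have ord_gt0 : 1 <= #[t * s]%g%:R :> R by rewrite ler1n order_gt0.
move: pq0; rewrite expg_order (rep1 repr) mulmx1 => def_b.
have q1 : (q - 1) *: b = - (p *: a).
  by rewrite scalerBl scale1r {2}def_b opprD addrCA subrr addr0.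
have sq : (q - 1) ^+ 2 = p ^+ 2.
  have : form B ((q - 1) *: b) ((q - 1) *: b) = form B (p *: a) (p *: a).
    by rewrite q1 (formNl) (formNr Bsym) opprK.
  rewrite !formZl !(formZr Bsym) aa bb => eq2.
  by apply: (mulIf (_ : 2 != 0 :> R)); rewrite ?pnatr_eq0 // !expr2 -!mulrA.
have qp : q - 1 = p.
  by apply/eqP; rewrite -(eqrXn2 (n := 2)) ?sq //; lra.
apply: (scalerI (a := p)); first by apply: lt0r_neq0; lra.
by rewrite scalerN -{2}qp q1 opprK.
Qed.

(** Since [- B i k] is at least [1] as soon as the order of [e i * e k] is at least 3, the
    conclusion says that [e i] and [e k] commute. *)
Lemma heavy_edge_isolated i j k :
    (forall i j, i != j -> B i j <= 0) -> i != j -> i != k -> j != k ->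
    3 <= B i j ^+ 2 -> - 1 < B i k.
Proof.
move=> Bneg ij ik jk heavy; rewrite ltNge; apply/negP => Bik.
(* The image of the root of [e i] under [e j * e i]. If [B i k <= - 1], its product with the root of
   [e k] is at most [- 2], so it is the negative of that root; but its coordinate [i] is at least
   [2]. *)
pose a : 'rV[R]_n := (B i j ^+ 2 - 1) *: delta_mx 0 i - B i j *: delta_mx 0 j.
have ra : is_root W e rho a (e i ^ (e j * e i))%g.
  exists i, (e j * e i)%g; split; rewrite ?groupM //.
  rewrite rhoM // mulmxA !(rep_e repr) (mul_refl_mx B (delta_mx 0 i) (delta_mx 0 j)).
  rewrite mulmxBl -scalemxAl refl_mx_self ?(simple_norm repr) //.
  rewrite (mul_refl_mx B (delta_mx 0 j)) !form_delta.
  have -> : B j i = B i j by rewrite -[in LHS]Bsym mxE.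
  by apply/rowP => l; rewrite !mxE; ring.
have form_ak : form B a (delta_mx 0 k) = (B i j ^+ 2 - 1) * B i k - B i j * B j k.
  by rewrite formDl formNl !formZl !form_delta.
have prod_ge0 : 0 <= B i j * B j k by rewrite mulr_le0 ?Bneg.
have prod_le : (B i j ^+ 2 - 1) * B i k <= - 2.
  have : (B i j ^+ 2 - 1) * B i k <= (B i j ^+ 2 - 1) * (- 1) by rewrite ler_wpM2l //; lra.
  by move/le_trans; apply; lra.
have ak : form B a (delta_mx 0 k) <= - 2 by rewrite form_ak; lra.
have /rowP/(_ i) := root_form_bound ra (root_e repr k) ak.
rewrite !mxE !eqxx (negPf ij) (negPf ik) /= mulr1 mulr0 => H; lra.
Qed.

End RealRepresentation.

(** * Positivity of roots and faithfulness of the representation *)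

Section Positivity.
Variables (gT : finGroupType) (W : {group gT}) (n : nat) (e : 'I_n -> gT).
Variables (R : realFieldType) (B : 'M[R]_n) (rho : gT -> 'M[R]_n).
Hypotheses (repr : geomrep W e B rho) (e_inj : injective e).
Hypothesis cheb_ge0 :
  forall i j k, i != j -> (k <= #[e i * e j]%g)%N -> 0 <= cheb (- B i j) k.

Let coxWS := rep_cox repr.
Let S : {set gT} := [set e i | i in 'I_n].
Let len := word_length S.

Let defW : W :=: <<S>>%g := cox_gen coxWS.
Let Se i : e i \in S := S_e e i.
Let We := W_e repr.
Let ee i : (e i * e i = 1)%g := cox_inv coxWS (Se i).

Lemma lenM i x : x \in W -> (len (e i * x)%g <= (len x).+1)%N.
Proof. by rewrite defW; apply: word_lengthM. Qed.

Lemma len_alt i j k x : x \in W -> (len (alt (e i) (e j) k * x)%g <= k + len x)%N.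
Proof.
move=> xW; elim: k i j => [|k IHk] i j; first by rewrite mul1g.
rewrite /= -mulgA addSn; apply: leq_trans (lenM _ _) _; last by rewrite ltnS.
by rewrite groupM //; elim: k {IHk} i j => //= k IHk i j; rewrite groupM.
Qed.

Lemma W_alt i j k : alt (e i) (e j) k \in W.
Proof. by elim: k i j => //= k IHk i j; rewrite groupM. Qed.

(** For [- B i j = 2 cos (pi / m)] the coefficients are values of [sin (l pi / m) / sin (pi / m)]
    with [l] equal to [k] or [k + 1], hence nonnegative as long as [k < m]. *)
Lemma rep_alt i j k : i != j ->
  (delta_mx 0 i : 'rV_n) *m rho (alt (e j) (e i) k) =
  (if odd k then cheb (- B i j) k else cheb (- B i j) k.+1) *: delta_mx 0 i +
  (if odd k then cheb (- B i j) k.+1 else cheb (- B i j) k) *: delta_mx 0 j.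
Proof.
move=> ij; elim: k => [|k IHk].
  by rewrite (rep1 repr) mulmx1 /= scale1r scale0r addr0.
rewrite alt_last (repM repr) ?W_alt //; last by case: (odd k).
rewrite mulmxA IHk mulmxDl -!scalemxAl chebSS [odd k.+1]/=.
have Bji : B j i = B i j by rewrite -[in LHS](rep_sym repr) mxE.
case: (odd k) => /=; rewrite (rep_e repr) !mul_refl_mx !form_delta (rep_diag repr) ?Bji;
  by apply/rowP => l; rewrite !mxE; ring.
Qed.

(* Tits: write [w = u v] with [u] alternating in [e j], [e i], lengths adding and
   [u] as long as possible. *)
Lemma tits_positivity w i : w \in W -> (len w <= len (e i * w)%g)%N ->
  forall l, 0 <= ((delta_mx 0 i : 'rV_n) *m rho w) 0 l.
Proof.
have [N] := ubnP (len w); elim: N w i => // N IH w i ltN wW lew l.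
have [w1|w1] := eqVneq w 1%g.
  by rewrite w1 (rep1 repr) mulmx1 mxE ler0n.
have wS : w \in <<S>>%g by rewrite -defW.
have [a [y [/imsetP[j _ def_a] yW def_w lty]]] := word_length_cons wS w1.
rewrite def_a in def_w; rewrite -defW in yW.
have ij : i != j.
  by apply: contraTneq lew => ->; rewrite -ltnNge def_w mulgA ee mul1g -def_w.
pose rest k := ((alt (e j) (e i) k)^-1 * w)%g.
have Wrest k : rest k \in W by rewrite groupM ?groupV ?W_alt.
have def_rest k : w = (alt (e j) (e i) k * rest k)%g by rewrite mulKVg.
pose Q k := (k + len (rest k) == len w)%N.
have Q1 : Q 1%N.
  rewrite /Q /rest /= mulg1 (mulg1_eq (ee j)) def_w mulgA ee mul1g -def_w add1n.
  by rewrite eqn_leq lty def_w lenM.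
have Qle k : Q k -> (k <= len w)%N by move/eqP <-; apply: leq_addr.
have exQ : exists k, Q k by exists 1%N.
have [k Qk kmax] := ex_maxnP exQ Qle.
have k_gt0 : (0 < k)%N by apply: kmax.
set v := rest k; have lenv : (k + len v = len w)%N by apply/eqP.
have alt_rest k' x : x \in W -> w = (alt (e j) (e i) k' * x)%g -> (len w <= k' + len x)%N.
  by move=> xW ->; apply: len_alt.
(* [e c] is the last letter of the alternating prefix and [e d] the letter that would continue it.
   If [e d] shortened [v], the prefix could be extended, against the maximality of [k]. *)
pose c := if odd k then j else i; pose d := if odd k then i else j.
have le_d : (len v <= len (e d * v)%g)%N.
  rewrite leqNgt; apply/negP => lt_d.
  have restS : rest k.+1 = (e d * v)%g.
    rewrite /rest alt_last invMg -mulgA -/v /d; congr (_ * _)%g.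
    by case: (odd k); rewrite (mulg1_eq (ee _)).
  suff : Q k.+1 by move/kmax; rewrite ltnn.
  rewrite /Q restS eqn_leq -lenv addSn ltn_add2l lt_d /=.
  have := alt_rest k.+1 (rest k.+1) (Wrest _) (def_rest _).
  by rewrite restS -lenv addSn.
(* Otherwise dropping the last letter of the prefix would write [w] with fewer letters than its
   length. *)
have le_c : (len v <= len (e c * v)%g)%N.
  rewrite leqNgt; apply/negP => lt_c.
  have restP : rest k.-1 = (e c * v)%g.
    have altP : alt (e j) (e i) k = (alt (e j) (e i) k.-1 * e c)%g.
      by rewrite /c; case: (k) k_gt0 => // k' _; rewrite alt_last /=; case: (odd k').
    by rewrite /v /rest altP invMg -!mulgA mulKVg.
  have := alt_rest k.-1 (rest k.-1) (Wrest _) (def_rest _).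
  by rewrite restP -lenv => le_k; move: lt_c k_gt0 le_k; lia.
have le_both h : h \in [:: i; j] -> (len v <= len (e h * v)%g)%N.
  rewrite !inE /c /d in le_c le_d *.
  by case: (odd k) in le_c le_d *; case/orP=> /eqP->.
have lt_v : (len v < N)%N by move: ltN; rewrite -lenv; lia.
have pos h : h \in [:: i; j] -> 0 <= ((delta_mx 0 h : 'rV_n) *m rho v) 0 l.
  by move=> hij; apply: IH => //; [apply: Wrest | apply: le_both].
(* Otherwise the braid relation lets the prefix start with [e i], and [e i * w] is shorter than
   [w]. *)
have lt_k : (k < #[e j * e i]%g)%N.
  rewrite ltnNge; apply/negP; set m := #[_]%g => mk.
  have m_gt0 : (0 < m)%N := order_gt0 _.
  have brd := alt_braid (ee j) (ee i) (expg_order (e j * e i)%g).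
  have def_iw : (e i * w = alt (e j) (e i) m.-1 *
      ((if odd m then alt (e i) (e j) (k - m) else alt (e j) (e i) (k - m)) * v))%g.
    rewrite (def_rest k) -{1}(subnKC mk) alt_add brd -/m -{1}(prednK m_gt0) /=.
    by rewrite !mulgA ee mul1g.
  have : (len (e i * w)%g <= m.-1 + (k - m + len v))%N.
    rewrite def_iw; apply: leq_trans (len_alt _ _ _ _) _.
      by case: ifP => _; rewrite groupM ?W_alt ?Wrest.
    by rewrite leq_add2l; case: ifP => _; rewrite len_alt ?Wrest.
  by move: lew lenv m_gt0 mk; lia.
rewrite (def_rest k) -/v (repM repr) ?W_alt ?Wrest // mulmxA rep_alt //.
have ord_sym : #[e j * e i]%g = #[e i * e j]%g.
  by rewrite -orderV invMg !(mulg1_eq (ee _)).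
rewrite ord_sym in lt_k; rewrite mulmxDl -!scalemxAl.
have := pos j _; have := pos i _; rewrite !inE !eqxx orbT => /(_ isT) posi /(_ isT) posj.
move: (_ *m _) posi (_ *m _) posj => ui posi uj posj; rewrite !mxE.
by rewrite addr_ge0 // mulr_ge0 //; case: ifP => _; apply: cheb_ge0 => //; lia.
Qed.

(** If [w] is not [1], some [e j] shortens it to [y], and the root of [e j] has a nonnegative image
    under [y]. But [y = e j * w] acts as [e j], which negates this root. *)
Lemma rep_faithful w : w \in W -> rho w = 1%:M -> w = 1%g.
Proof.
move=> wW rw; apply/eqP; apply: contraT => w1.
have wS : w \in <<S>>%g by rewrite -defW.
have [a [y [/imsetP[j _ def_a] yW def_w lty]]] := word_length_cons wS w1.
rewrite def_a in def_w; rewrite -defW in yW.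
have := @tits_positivity y j yW; rewrite -def_w => /(_ (ltnW lty) j) pos.
have def_y : y = (e j * w)%g by rewrite def_w mulgA ee mul1g.
have := pos; rewrite def_y (repM repr) // rw mulmx1 (rep_e repr).
by rewrite refl_mx_self ?(simple_norm repr) // !mxE !eqxx /= ler0N1.
Qed.

Lemma root_inj v t s : is_root W e rho v t -> is_root W e rho v s -> t = s.
Proof.
move=> rt rs; have tW := root_W repr rt; have sW := root_W repr rs.
apply: (mulIg s^-1%g); rewrite mulgV; apply: rep_faithful.
  by rewrite groupM ?groupV.
by rewrite (repM repr) ?groupV // (root_rep repr rt) -(root_rep repr rs) (repVr repr).
Qed.

End Positivity.

(** * The ring Z[sqrt 2, tau] *)

(* [(p, q) : quad_ext a b] stands for [p + q X] in [K[X] / (X^2 - a X - b)]. *)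
Definition quad_ext (K : comNzRingType) (a b : K) : Type := (K * K)%type.

Section QuadraticExtension.
Variables (K : comNzRingType) (a b : K).
Local Notation Q := (quad_ext a b).

HB.instance Definition _ := GRing.Zmodule.copy Q (K * K)%type.

Definition quad_one : Q := (1, 0).
Definition quad_mul (x y : Q) : Q :=
  (x.1 * y.1 + b * (x.2 * y.2), x.1 * y.2 + x.2 * y.1 + a * (x.2 * y.2)).

Fact quad_mulA : associative quad_mul.
Proof. by move=> [p q] [r s] [u v]; congr (_, _) => /=; ring. Qed.
Fact quad_mulC : commutative quad_mul.
Proof. by move=> [p q] [r s]; congr (_, _) => /=; ring. Qed.
Fact quad_mul1 : left_id quad_one quad_mul.
Proof. by move=> [p q]; congr (_, _) => /=; ring. Qed.
Fact quad_mulD : left_distributive quad_mul +%R.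
Proof. by move=> [p q] [r s] [u v]; congr (_, _) => /=; ring. Qed.
Fact quad_one_neq0 : quad_one != 0.
Proof. by apply/eqP => -[/eqP]; rewrite oner_eq0. Qed.

HB.instance Definition _ := GRing.Zmodule_isComNzRing.Build Q
  quad_mulA quad_mulC quad_mul1 quad_mulD quad_one_neq0.

Section Evaluation.
Variables (R : comNzRingType) (f : {rmorphism K -> R}) (y : R).

(** The relation satisfied by [y] is an argument, so that the structure of ring morphism can be
    attached to [quad_eval yy]. *)
Definition quad_eval of y ^+ 2 = f a * y + f b := fun x : Q => f x.1 + f x.2 * y.

Hypothesis yy : y ^+ 2 = f a * y + f b.

Fact quad_eval_additive : {morph quad_eval yy : x z / x - z}.
Proof. by move=> [p q] [r s]; rewrite /quad_eval /= !rmorphB /=; ring. Qed.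
Fact quad_eval_multiplicative : monoid_morphism (quad_eval yy).
Proof.
split=> [|[p q] [r s]]; rewrite /quad_eval /= ?rmorph1 ?rmorph0 ?mul0r ?addr0 //.
rewrite !rmorphD !rmorphM /=.
apply/eqP; rewrite -subr_eq0; apply/eqP.
transitivity (f q * f s * (f a * y + f b - y ^+ 2)); first ring.
by rewrite yy subrr mulr0.
Qed.

HB.instance Definition _ := GRing.isZmodMorphism.Build Q R (quad_eval yy) quad_eval_additive.
HB.instance Definition _ :=
  GRing.isMonoidMorphism.Build Q R (quad_eval yy) quad_eval_multiplicative.

End Evaluation.
End QuadraticExtension.

Definition goldZ := quad_ext (1 : int) 1.
HB.instance Definition _ := GRing.ComNzRing.on goldZ.

(* Z[sqrt 2, tau] with [tau] the golden ratio; [((p, r), (q, s))] stands for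
   [p + r tau + (q + s tau) sqrt 2]. *)
Definition gold2Z := quad_ext (0 : goldZ) 2.
HB.instance Definition _ := GRing.ComNzRing.on gold2Z.

Definition sqrt2 : gold2Z := (0, 1).
Definition tau : gold2Z := ((0, 1), 0).

Lemma int_between1 (r : int) : (-1 < r)%R -> (r < 1)%R -> r = 0.
Proof. by lia. Qed.

Lemma int_between2 (r : int) : (-2 < r)%R -> (r < 2)%R -> r = -1 \/ r = 0 \/ r = 1.
Proof. by lia. Qed.

Lemma int_between4 (p : int) : (-4 < p)%R -> (p < 4)%R ->
  p = -3 \/ p = -2 \/ p = -1 \/ p = 0 \/ p = 1 \/ p = 2 \/ p = 3.
Proof. by lia. Qed.

Section Embeddings.
Variable R : realFieldType.

Section Embedding.
Variables t y : R.
Hypotheses (tt : t ^+ 2 = t + 1) (yy : y ^+ 2 = 2).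

Fact gold_rel : t ^+ 2 = (1 : int)%:~R * t + (1 : int)%:~R.
Proof. by rewrite mul1r. Qed.

Definition gold_embed : {rmorphism goldZ -> R} :=
  quad_eval (f := intmul 1) gold_rel.

Fact gold2_rel : y ^+ 2 = gold_embed 0 * y + gold_embed 2.
Proof. by rewrite rmorph0 mul0r add0r rmorph_nat. Qed.

Definition embed : {rmorphism gold2Z -> R} := quad_eval gold2_rel.

Lemma embedE (p r q s : int) :
  embed ((p, r), (q, s)) = p%:~R + r%:~R * t + (q%:~R + s%:~R * t) * y.
Proof. by []. Qed.

Lemma embed_sqrt2 : embed sqrt2 = y.
Proof. by rewrite embedE; ring. Qed.

Lemma embed_tau : embed tau = t.
Proof. by rewrite embedE; ring. Qed.

End Embedding.

Variables a b : R.
Hypotheses (a_gt0 : 0 < a) (aa : a ^+ 2 = 2) (b_gt0 : 0 < b) (bb : b ^+ 2 = 5).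

Definition golden (d : bool) : R := (1 + (-1) ^+ d * b) / 2.
Definition signed_sqrt2 (d : bool) : R := (-1) ^+ d * a.

Fact golden_sq d : golden d ^+ 2 = golden d + 1.
Proof.
have -> : golden d ^+ 2 = (1 + 2 * ((-1) ^+ d * b) + ((-1) ^+ d) ^+ 2 * b ^+ 2) / 4.
  by rewrite /golden; field.
by rewrite sqrr_sign bb /golden; field.
Qed.

Fact signed_sqrt2_sq d : signed_sqrt2 d ^+ 2 = 2.
Proof. by rewrite exprMn sqrr_sign mul1r. Qed.

(** The four embeddings of Z[sqrt 2, tau] into the reals, indexed by the signs of sqrt 5 and sqrt
    2. *)
Definition conj_embed (d : bool * bool) : {rmorphism gold2Z -> R} :=
  embed (golden_sq d.1) (signed_sqrt2_sq d.2).

Lemma between_squares (l u x : R) :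
  0 <= l -> 0 <= u -> 0 < x -> l ^+ 2 < x ^+ 2 < u ^+ 2 -> l < x < u.
Proof. by move=> l0 u0 x0; rewrite !ltr_pXn2r ?nnegrE // ltW. Qed.

Lemma sqrt2_bound : 141 / 100 < a < 142 / 100.
Proof.
by apply: between_squares => //; rewrite ?aa; try apply/andP; try split; lra.
Qed.
Lemma sqrt5_bound : 223 / 100 < b < 224 / 100.
Proof.
by apply: between_squares => //; rewrite ?bb; try apply/andP; try split; lra.
Qed.

(** The two conjugates differ by [r] times sqrt 5, which bounds [r] and then [p]; the rest is a
    finite check. *)
Lemma goldZ_bounded (p r : int) :
    (forall d, - 2 <= p%:~R + r%:~R * golden d <= 2) ->
  (p, r) \in [:: (0, 0); (1, 0); (-1, 0); (2, 0); (-2, 0);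
                 (0, 1); (0, -1); (-1, 1); (1, -1)].
Proof.
move=> bnd; have := bnd true; have := bnd false; rewrite /golden expr0 expr1 => /andP[b1 b2] /andP[b3 b4].
have /andP[b5 b6] := sqrt5_bound.
have r_lt : (r < 2)%R by rewrite -(ltr_int R) ltNge; apply/negP => r2; nra.
have r_gt : (-2 < r)%R by rewrite -(ltr_int R) ltNge; apply/negP => r2; nra.
have p_lt : (p < 4)%R by rewrite -(ltr_int R) ltNge; apply/negP => r2; nra.
have p_gt : (-4 < p)%R by rewrite -(ltr_int R) ltNge; apply/negP => r2; nra.
have rE := int_between2 r_gt r_lt; have pE := int_between4 p_gt p_lt.
move: b1 b2 b3 b4; case: rE => [->|[->|->]];
  case: pE => [->|[->|[->|[->|[->|[->|->]]]]]] b1 b2 b3 b4; first [by [] | exfalso; lra].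
Qed.

(* The algebraic integers of the form [2 cos (k pi / m)] with [m <= 5]. *)
Definition small_values : seq gold2Z :=
  [:: 0; 1; -1; 2; -2; sqrt2; - sqrt2; tau; - tau; tau - 1; 1 - tau].

(** Half the sum and half the difference over the two signs of sqrt 2 bound [p + r tau] and
    [(q + s tau) sqrt 2], so that [goldZ_bounded] applies to both pairs. Numerical estimates exclude
    most of the remaining combinations. *)
Lemma bounded_conjugates (c : gold2Z) :
  (forall d, - 2 <= conj_embed d c <= 2) -> c \in small_values.
Proof.
case: c => [[p r] [q s]] bnd.
have bnd' d1 d2 : - 2 <= p%:~R + r%:~R * golden d1 +
    (q%:~R + s%:~R * golden d1) * signed_sqrt2 d2 <= 2 by exact: (bnd (d1, d2)).
have pr : (p, r) \in [:: (0, 0); (1, 0); (-1, 0); (2, 0); (-2, 0);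
                 (0, 1); (0, -1); (-1, 1); (1, -1)].
  apply: goldZ_bounded => d; have := bnd' d true; have := bnd' d false.
  by rewrite /signed_sqrt2 expr0 expr1; set x := _ + _ * golden d; set y := _ + _ * golden d; lra.
have /andP[a1 a2] := sqrt2_bound.
have qs : (q, s) \in [:: (0, 0); (1, 0); (-1, 0); (2, 0); (-2, 0);
                 (0, 1); (0, -1); (-1, 1); (1, -1)].
  apply: goldZ_bounded => d; have := bnd' d true; have := bnd' d false.
  rewrite /signed_sqrt2 expr0 expr1; set x := _ + _ * golden d; set y := _ + _ * golden d.
  move=> /andP[c1 c2] /andP[c3 c4]; apply/andP; split; nra.
have /andP[b1 b2] := sqrt5_bound.
have [h1 h2] : 31 / 10 < a * b /\ a * b < 32 / 10 by split; nra.
move: (bnd' true true) (bnd' true false) (bnd' false true) (bnd' false false).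
rewrite /signed_sqrt2 /golden expr0 expr1 {bnd bnd'}.
move: qs; rewrite !inE => qs /andP[c1 c2] /andP[c3 c4] /andP[c5 c6] /andP[c7 c8].
have qs0 : [|| (q, s) == (0, 0), (q, s) == (1, 0) | (q, s) == (-1, 0)].
  apply: contraT => qsN; exfalso; move: c1 c2 c3 c4 c5 c6 c7 c8 qsN.
  by repeat (case/orP: qs => qs); case/eqP: qs => -> -> //= c1 c2 c3 c4 c5 c6 c7 c8 _; lra.
have pr0 : (q, s) != (0, 0) -> (p, r) == (0, 0).
  have [//|qsN _] := eqVneq (q, s) (0, 0); rewrite (negPf qsN) /= in qs0.
  have {qs qsN} qE : s = 0 /\ (q = 1 \/ q = -1).
    by case/orP: qs0 => /eqP[-> ->]; split=> //; [left | right].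
  have [rb1 rb2] : r%:~R * b < 2 /\ - 2 < r%:~R * b.
    by split; case: qE c1 c2 c3 c4 c5 c6 c7 c8 => -> [] -> *; lra.
  have r0 : r = 0.
    have r_lt : (r < 1)%R.
      rewrite -(ltr_int R) ltNge; apply/negP => r1.
      by have : b <= r%:~R * b by [rewrite ler_peMl // ltW]; lra.
    have r_gt : (-1 < r)%R.
      rewrite -(ltr_int R) ltNge; apply/negP => r1.
      have b0 := ltW b_gt0.
      by have : b <= - r%:~R * b by [rewrite ler_peMl //; lra]; lra.
    exact: int_between1 r_gt r_lt.
  have p_lt : (p < 1)%R by rewrite -(ltr_int R); case: qE c1 c2 c3 c4 c5 c6 c7 c8 => -> [] ->; rewrite r0 => *; lra.
  have p_gt : (-1 < p)%R by rewrite -(ltr_int R); case: qE c1 c2 c3 c4 c5 c6 c7 c8 => -> [] ->; rewrite r0 => *; lra.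
  by rewrite r0 (int_between1 p_gt p_lt).
clear - pr qs0 pr0; move: pr; rewrite !inE.
have [[-> ->]|qsN] := eqVneq (q, s) (0, 0).
  by repeat (case/orP=> [/eqP[-> ->] //|]); case/eqP=> -> ->.
by case/eqP: (pr0 qsN) => -> -> _; move: qs0; rewrite (negPf qsN) /= => /orP[] /eqP[-> ->].
Qed.

Lemma conj_embed_inj (x z : gold2Z) : (forall d, conj_embed d x = conj_embed d z) -> x = z.
Proof.
move=> xz; apply/eqP; rewrite -subr_eq0; apply/eqP.
have {xz} : forall d, conj_embed d (x - z) = 0 by move=> d; rewrite rmorphB xz subrr.
case: (x - z) => [[p r] [q s]] e0.
have e0' d1 d2 : p%:~R + r%:~R * golden d1 +
    (q%:~R + s%:~R * golden d1) * signed_sqrt2 d2 = 0 by exact: (e0 (d1, d2)).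
have int0 (k l : int) : (forall d, k%:~R + l%:~R * golden d = 0) -> (k, l) = (0, 0).
  move=> kl; have := kl true; have := kl false; rewrite /golden expr0 expr1 => k1 k2.
  have : l%:~R * b = 0 by lra.
  move/eqP; rewrite mulf_eq0 (gt_eqF b_gt0) orbF intr_eq0 => /eqP l0.
  have : k%:~R = 0 :> R by move: k1; rewrite l0 mul0r addr0.
  by move/eqP; rewrite intr_eq0 l0 => /eqP ->.
have [-> ->] : (p, r) = (0, 0).
  apply: int0 => d; have := e0' d true; have := e0' d false.
  rewrite /signed_sqrt2 expr0 expr1; set u := _ + _ * golden d; set w := _ + _ * golden d; lra.
have [-> ->] // : (q, s) = (0, 0).
apply: int0 => d; have := e0' d true; have := e0' d false.
rewrite /signed_sqrt2 expr0 expr1; set u := _ + _ * golden d; set w := _ + _ * golden d => h1 h2.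
have /eqP : w * a = 0 by lra.
by rewrite mulf_eq0 (gt_eqF a_gt0) orbF => /eqP.
Qed.

End Embeddings.

(** * Systems with all orders at most 5 *)

Section BaseChange.
Variables (gT : finGroupType) (W : {group gT}) (n : nat) (e : 'I_n -> gT).
Variables (K L : comNzRingType) (f : {rmorphism K -> L}) (B : 'M[K]_n) (rho : gT -> 'M[K]_n).

Lemma map_form u v : form (map_mx f B) (map_mx f u) (map_mx f v) = f (form B u v).
Proof. by rewrite /form map_trmx -!map_mxM mxE. Qed.

Lemma map_geomrep : geomrep W e B rho -> geomrep W e (map_mx f B) (fun x => map_mx f (rho x)).
Proof.
case=> cox sym diag [rM re r1]; split=> //.
- by rewrite map_trmx sym.
- by move=> i; rewrite mxE diag rmorph_nat.
split=> [x y xW yW|i|]; first by rewrite rM // map_mxM.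
  by rewrite re /refl_mx map_mxB !map_mxM map_mx1 -map_trmx map_delta_mx.
by rewrite r1 map_mx1.
Qed.

Lemma map_root v t : is_root W e rho v t -> is_root W e (fun x => map_mx f (rho x)) (map_mx f v) t.
Proof.
by case=> i [x [xW -> ->]]; exists i, x; rewrite map_mxM map_delta_mx.
Qed.

Lemma rmorph_cheb x k : f (cheb x k) = cheb (f x) k.
Proof.
have [m] := ubnP k; elim: m k => // m IH [|[|k]] km; rewrite ?rmorph0 ?rmorph1 //.
by rewrite !chebSS rmorphB rmorphM !IH //; lia.
Qed.

End BaseChange.

(** This is [2 cos (pi / m)] for [2 <= m <= 5]; the default [0] is the true value at [m = 2] and
    junk elsewhere. *)
Definition two_cos (m : nat) : gold2Z :=
  match m with 3 => 1 | 4 => sqrt2 | 5 => tau | _ => 0 end.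

Section SmallOrders.
Variables (gT : finGroupType) (W : {group gT}) (n : nat) (e : 'I_n -> gT).
Hypotheses (coxWS : coxeter_system W [set e i | i in 'I_n]) (e_inj : injective e).
Hypothesis small : forall i j, (#[e i * e j]%g <= 5)%N.
Variable R : rcfType.

Let a : R := Num.sqrt 2.
Let b : R := Num.sqrt 5.
Let a_gt0 : 0 < a. Proof. by rewrite sqrtr_gt0. Qed.
Let b_gt0 : 0 < b. Proof. by rewrite sqrtr_gt0. Qed.
Let aa : a ^+ 2 = 2. Proof. by rewrite sqr_sqrtr. Qed.
Let bb : b ^+ 2 = 5. Proof. by rewrite sqr_sqrtr. Qed.
Let emb (d : bool * bool) : {rmorphism gold2Z -> R} := conj_embed aa bb d.

Definition gold_form : 'M[gold2Z]_n :=
  \matrix_(i, j) if i == j then 2 else - two_cos #[e i * e j]%g.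

Let ee i : (e i * e i = 1)%g. Proof. by apply: (cox_inv coxWS); apply: imset_f. Qed.

Lemma order_sym i j : #[e j * e i]%g = #[e i * e j]%g.
Proof. by rewrite -orderV invMg !(mulg1_eq (ee _)). Qed.

Lemma order_gt1 i j : i != j -> (1 < #[e i * e j]%g)%N.
Proof.
move=> ij; rewrite ltn_neqAle order_gt0 eq_sym andbT order_eq1.
apply: contra ij => /eqP ij1; apply/eqP/e_inj.
by rewrite -(mulg1_eq ij1) (mulg1_eq (ee i)).
Qed.

Lemma order_small i j : i != j -> #[e i * e j]%g \in [:: 2; 3; 4; 5]%N.
Proof.
move=> /order_gt1; move: (small i j); case: #[_]%g => [|[|[|[|[|[|m]]]]]] //.
Qed.

Lemma emb_inj x y : (forall d, emb d x = emb d y) -> x = y.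
Proof. exact: conj_embed_inj. Qed.

Lemma gold_coxeter_form : coxeter_form e gold_form.
Proof.
split.
- by apply/matrixP => i j; rewrite !mxE eq_sym order_sym.
- by move=> i; rewrite mxE eqxx.
move=> i j ij /=; rewrite mxE (negPf ij).
(* Regularity of [4 - c ^+ 2] is tested in the embeddings: this element is [3], [2] or, for
   [c = - tau], a divisor of [5]. *)
have reg x : (forall d, emb d (4 - (- x) ^+ 2) != 0) -> forall y, (4 - (- x) ^+ 2) * y = 0 -> y = 0.
  move=> nz y xy0; apply: emb_inj => d; rewrite rmorph0.
  by apply: (mulfI (nz d)); rewrite -rmorphM xy0 rmorph0 mulr0.
have := order_small ij; rewrite !inE => /or4P[] /eqP -> /=.
- by left; rewrite oppr0.
- right; split; try by apply/eqP.
  by apply: reg => d; have -> : 4 - (- 1) ^+ 2 = 3%:R :> gold2Z; [apply/eqP | rewrite rmorph_nat pnatr_eq0].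
- right; split; try by apply/eqP.
  by apply: reg => d; have -> : 4 - (- sqrt2) ^+ 2 = 2%:R :> gold2Z; [apply/eqP | rewrite rmorph_nat pnatr_eq0].
right; split; try by apply/eqP.
apply: reg => d; have prod : (4 - (- tau) ^+ 2) * (2 + tau) = 5%:R by apply/eqP.
have prod' : emb d (4 - (- tau) ^+ 2) * emb d (2 + tau) = 5 by rewrite -rmorphM prod rmorph_nat.
by apply: contra_eq_neq prod' => ->; rewrite mul0r eq_sym pnatr_eq0.
Qed.

Variable rho : gT -> 'M[gold2Z]_n.
Hypothesis repr : geomrep W e gold_form rho.
Let B := gold_form.
Let root := is_root W e rho.
Let rhoR d x : 'M[R]_n := map_mx (emb d) (rho x).
Let reprR d : geomrep W e (map_mx (emb d) B) (rhoR d) := map_geomrep (emb d) repr.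

(** Each embedding gives a real representation of the finite group [W], to which [root_form_bound]
    applies with [u] and with [- u]. *)
Lemma root_form_le2 v t u s : root v t -> root u s -> form B v u \in small_values.
Proof.
move=> rv ru; apply: (bounded_conjugates (aa := aa) (bb := bb) a_gt0 b_gt0) => d.
rewrite -/(emb d) -map_form; have rvR := map_root (emb d) rv.
have lower u' s' : root u' s' -> - 2 <= form (map_mx (emb d) B) (map_mx (emb d) v) (map_mx (emb d) u').
  move=> ru'; have ruR := map_root (emb d) ru'; rewrite leNgt; apply/negP => lt2.
  have vu := root_form_bound (reprR d) rvR ruR (ltW lt2).
  by move: lt2; rewrite vu formNl (root_norm (reprR d) ruR) ltxx.
have := lower _ _ (rootN repr ru).
by rewrite map_mxN (formNr (rep_sym (reprR d))) lerN2 => ->; rewrite (lower _ _ ru).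
Qed.

Lemma root_form2_eq v t u s : root v t -> root u s -> form B v u = 2 -> v = u.
Proof.
move=> rv ru vu2; apply/rowP => j; apply: emb_inj => d.
have ruN := map_root (emb d) (rootN repr ru).
have := root_form_bound (reprR d) (map_root (emb d) rv) ruN.
rewrite map_form (formNr (rep_sym repr)) vu2 rmorphN rmorph_nat => /(_ (lexx _)).
by rewrite map_mxN opprK => /rowP/(_ j); rewrite !mxE.
Qed.

(** Two expressions for the reflection of [v] give [2 v = c u], and pairing with [v] gives
    [c ^+ 2 = 4]. In the list of small values this leaves [2] and [- 2]. *)
Lemma root_unique v u t : root v t -> root u t -> v = u \/ v = - u.
Proof.
move=> rv ru; have := root_rep repr rv; rewrite (root_rep repr ru) => eq_refl.
set c := form B v u.
have vu : v *+ 2 = c *: u.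
  have := refl_mx_self (root_norm repr rv); rewrite -eq_refl mul_refl_mx -/c => /eqP.
  by rewrite subr_eq addrC -subr_eq opprK mulr2n => /eqP.
have cc : c ^+ 2 = 4.
  have := congr1 (form B v) vu; rewrite mulr2n (formDr (rep_sym repr)) (formZr (rep_sym repr)).
  by rewrite (root_norm repr rv) -/c -expr2 => <-; ring.
have : c \in [:: 2; -2].
  have := root_form_le2 rv ru; rewrite -/c !inE.
  by repeat (case/orP=> [/eqP c0|]); [..|move/eqP=> c0]; move: cc; rewrite c0.
rewrite !inE => /orP[] /eqP c2; first by left; apply: root_form2_eq rv ru c2.
right; apply: root_form2_eq rv (rootN repr ru) _.
by rewrite (formNr (rep_sym repr)) -/c c2 opprK.
Qed.

(** Positivity is read in the embedding where sqrt 2 and sqrt 5 are positive, which is the one that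
    sends [two_cos m] to [2 cos (pi / m)]. *)
Lemma gold_cheb_ge0 i j k : i != j -> (k <= #[e i * e j]%g)%N ->
  0 <= cheb (- map_mx (emb (false, false)) B i j) k.
Proof.
move=> ij; rewrite !mxE (negPf ij) rmorphN opprK -rmorph_cheb.
have : cheb (two_cos #[e i * e j]%g) k \in [:: 0; 1; sqrt2; tau] ->
    0 <= emb (false, false) (cheb (two_cos #[e i * e j]%g) k).
  rewrite !inE => /or4P[] /eqP ->; rewrite ?rmorph0 ?rmorph1 //.
    by rewrite [emb _ _]embed_sqrt2 /signed_sqrt2 expr0 mul1r ltW.
  by rewrite [emb _ _]embed_tau /golden expr0 mul1r; have := b_gt0; lra.
move=> H km; apply: H; move: km.
have := order_small ij; rewrite !inE => /or4P[] /eqP ->; by case: k => [|[|[|[|[|[|k]]]]]].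
Qed.

Lemma gold_root_inj v t s : root v t -> root v s -> t = s.
Proof.
move=> rt rs; apply: (root_inj (reprR (false, false)) gold_cheb_ge0).
  exact: map_root rt.
exact: map_root rs.
Qed.

(** [\det B] may fail to be a unit, but it is nonzero in every embedding. *)
Lemma gold_det_regular (x y : gold2Z) : \det B * x = \det B * y -> x = y.
Proof.
move=> eqB; apply: emb_inj => d; have := congr1 (emb d) eqB.
by rewrite !rmorphM -det_map_mx; apply: mulfI; apply: form_det_neq0 (reprR d).
Qed.

(** * The root lattice of a subgroup generated by reflections *)

Section Lattice.
Variables (P : 'M[gold2Z]_n) (t : 'I_n -> gT).
Hypothesis Pt : root_rows W e rho P t.
Let W' := <<[set t i | i in 'I_n]>>%g.

Definition subroot (v : 'rV[gold2Z]_n) := exists i x, x \in W' /\ v = row i P *m rho x.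

Lemma W'_sub x : x \in W' -> x \in W.
Proof.
move: x; apply/subsetP; rewrite gen_subG; apply/subsetP => _ /imsetP[i _ ->].
have := root_W repr (Pt i); by [].
Qed.

Lemma subroot_root v : subroot v -> exists2 s, root v s & s \in W'.
Proof.
case=> i [x [xW' ->]]; exists (t i ^ x)%g; first exact (rootJ repr (W'_sub xW') (Pt i)).
by rewrite groupJ // mem_gen // imset_f.
Qed.

Lemma subroot_refl v u : subroot v -> subroot u -> subroot (v - form B v u *: u).
Proof.
move=> [i [x [xW' ->]]] /subroot_root[s ru sW'].
exists i, (x * s)%g; split; first by rewrite groupM.
by rewrite (repM repr) ?W'_sub // mulmxA (root_rep repr ru) mul_refl_mx.
Qed.

Lemma subrootN v : subroot v -> subroot (- v).
Proof.
move=> sv; have [s rv _] := subroot_root sv; have := subroot_refl sv sv.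
rewrite (root_norm repr rv); congr subroot.
by rewrite scaler_nat mulr2n opprD addrA subrr add0r.
Qed.

Section Plane.
Variables (v g : 'rV[gold2Z]_n) (c : gold2Z).
Hypotheses (vv : form B v v = 2) (gg : form B g g = 2) (vg : form B v g = c).

Let lin (p : gold2Z * gold2Z) := p.1 *: v + p.2 *: g.

(** Reflection in coordinates relative to [v] and [g], so that chains of reflections can be checked
    by computation. *)
Definition refl2 (p q : gold2Z * gold2Z) :=
  let f := 2 * p.1 * q.1 + c * (p.1 * q.2 + p.2 * q.1) + 2 * p.2 * q.2 in
  (p.1 - f * q.1, p.2 - f * q.2).

Lemma lin_refl p q : lin p - form B (lin p) (lin q) *: lin q = lin (refl2 p q).
Proof.
have gv : form B g v = c by rewrite (formC (rep_sym repr)).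
case: p q => [p1 p2] [q1 q2]; rewrite /lin /refl2 /= !formDl !(formDr (rep_sym repr)) !formZl !(formZr (rep_sym repr)) vv gg vg gv.
by apply/rowP => j; rewrite !mxE; ring.
Qed.

Definition is_root_lin p := exists s, root (lin p) s.

Lemma root_lin p q : is_root_lin p -> is_root_lin q -> is_root_lin (refl2 p q).
Proof.
move=> [s rp] [r rq]; exists (s ^ r)%g; rewrite -lin_refl.
exact: (root_refl repr rp rq).
Qed.

Lemma subroot_lin p q : subroot (lin p) -> subroot (lin q) -> subroot (lin (refl2 p q)).
Proof. by move=> sp sq; rewrite -lin_refl; apply: subroot_refl. Qed.

End Plane.

(** A basis of Z[sqrt 2, tau] over the integers. *)
Definition lattice_scalars : seq gold2Z := [:: 1; sqrt2; tau; sqrt2 * tau].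

Definition positive_triples : seq (gold2Z * gold2Z * gold2Z) :=
  [:: (1, 1, 1); (1, 1, 2); (1, 1, 1 - tau); (1, sqrt2, sqrt2);
    (1, tau, tau); (1, tau, tau - 1); (tau, 1, tau); (tau, 1, tau - 1);
    (tau, tau, 1); (tau, tau, 2); (tau, tau, tau); (tau, sqrt2 * tau, sqrt2)].

Lemma positive_cases (eps m c : gold2Z) :
    eps \in [:: 1; tau] -> m \in lattice_scalars -> c \in small_values ->
  0 < (eps * m * c).1.1 -> (eps, m, c) \in positive_triples.
Proof.
have : all (fun eps : gold2Z => all (fun m => all (fun c => (0 < (eps * m * c).1.1) ==>
  ((eps, m, c) \in positive_triples)) small_values) lattice_scalars) [:: 1; tau].
  by vm_compute.
move=> /allP A /A/allP B1 /B1/allP C1 /C1 imp pos; exact: (implyP imp pos).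
Qed.

Lemma lattice_step (eps m : gold2Z) v g s :
    eps \in [:: 1; tau] -> m \in lattice_scalars -> root v s -> subroot g ->
    0 < (eps * m * form B v g).1.1 ->
  v = g \/ exists u eps', [/\ eps' \in [:: 1; tau], exists r, root u r,
    eps *: v - m *: g = eps' *: u & subroot u -> subroot v].
Proof.
move=> epsP mP rv sg pos; have [r rg _] := subroot_root sg.
have vv := root_norm repr rv; have gg := root_norm repr rg.
have := positive_cases epsP mP (root_form_le2 rv rg) pos.
case: (eqVneq (form B v g) 2) => [vg2 _|vgN]; first by left; apply: root_form2_eq rv rg vg2.
move: vgN; set c := form B v g => vgN cases; right.
have vg : form B v g = c by [].
pose lin (p : gold2Z * gold2Z) := p.1 *: v + p.2 *: g.
have linV : lin (1, 0) = v by rewrite /lin scale1r scale0r addr0.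
have linG : lin (0, 1) = g by rewrite /lin scale1r scale0r add0r.
have RV : is_root_lin v g (1, 0) by exists s; rewrite -/(lin _) linV.
have RG : is_root_lin v g (0, 1) by exists r; rewrite -/(lin _) linG.
have SG : subroot (lin (0, 1)) by rewrite linG.
have RR p q : is_root_lin v g p -> is_root_lin v g q -> is_root_lin v g (refl2 c p q).
  by move=> h1 h2; exact (root_lin vv gg vg h1 h2).
have SR p q : subroot (lin p) -> subroot (lin q) -> subroot (lin (refl2 c p q)).
  by move=> h1 h2; exact (subroot_lin vv gg vg h1 h2).
have SN p : subroot (lin p) -> subroot (lin (- p.1, - p.2)).
  by move/subrootN; rewrite /lin opprD !scaleNr.
have fin up eps' : eps' \in [:: 1; tau] -> is_root_lin v g up ->
    (eps' * up.1 == eps) && (eps' * up.2 == - m) -> (subroot (lin up) -> subroot (lin (1, 0))) ->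
    exists u eps', [/\ eps' \in [:: 1; tau], exists r, root u r,
      eps *: v - m *: g = eps' *: u & subroot u -> subroot v].
  move=> eps'P rup /andP[/eqP eq1 /eqP eq2]; rewrite linV => back.
  exists (lin up), eps'; split=> //.
  by rewrite /lin scalerDr !scalerA eq1 eq2 scaleNr.
have S1 p q : p == q -> subroot (lin p) -> subroot (lin q) by move/eqP->.
pose V : gold2Z * gold2Z := (1, 0); pose G : gold2Z * gold2Z := (0, 1).
have P1 : (1 : gold2Z) \in [:: 1; tau] by rewrite mem_head.
have Pt2 : tau \in [:: 1; tau] by rewrite !inE eqxx orbT.
move: cases fin vgN RR SR; rewrite /positive_triples !inE; clearbody c.
repeat (case/orP=> [/eqP[-> -> ->]|]); last move/eqP=> [-> -> ->]; move=> fin vgN RR SR.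
(* In each case the first chain produces [u], and the second one recovers [v] inside the roots of
   the subgroup. *)
- refine (fin (refl2 (1) V G) 1 P1 (RR _ _ RV RG) _ _); first by vm_compute.
  by move=> su; refine (S1 _ _ _ (SR _ _ su SG)); vm_compute.
- by [].
- refine (fin (refl2 (1 - tau) (refl2 (1 - tau) G V) G) tau Pt2 (RR _ _ (RR _ _ RG RV) RG) _ _); first by vm_compute.
  by move=> su; refine (S1 _ _ _ (SR _ _ SG su)); vm_compute.
- refine (fin (refl2 (sqrt2) V G) 1 P1 (RR _ _ RV RG) _ _); first by vm_compute.
  by move=> su; refine (S1 _ _ _ (SR _ _ su SG)); vm_compute.
- refine (fin (refl2 (tau) V G) 1 P1 (RR _ _ RV RG) _ _); first by vm_compute.
  by move=> su; refine (S1 _ _ _ (SR _ _ su SG)); vm_compute.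
(* Reflecting [G] in itself is a way to obtain [- G]. *)
- refine (fin (refl2 (tau - 1) (refl2 (tau - 1) G G) V) tau Pt2 (RR _ _ (RR _ _ RG RG) RV) _ _); first by vm_compute.
  by move=> su; refine (S1 _ _ _ (SR _ _ (SR _ _ su SG) su)); vm_compute.
- refine (fin (refl2 tau (refl2 tau G G) V) 1 P1 (RR _ _ (RR _ _ RG RG) RV) _ _); first by vm_compute.
  by move=> su; refine (S1 _ _ _ (SN _ (SR _ _ (SR _ _ SG su) SG))); vm_compute.
- refine (fin (refl2 (tau - 1) V G) tau Pt2 (RR _ _ RV RG) _ _); first by vm_compute.
  by move=> su; refine (S1 _ _ _ (SR _ _ su SG)); vm_compute.
- refine (fin (refl2 (1) V G) tau Pt2 (RR _ _ RV RG) _ _); first by vm_compute.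
  by move=> su; refine (S1 _ _ _ (SR _ _ su SG)); vm_compute.
- by [].
- refine (fin (refl2 tau (refl2 tau V G) V) 1 P1 (RR _ _ (RR _ _ RV RG) RV) _ _); first by vm_compute.
  by move=> su; refine (S1 _ _ _ (SR _ _ SG su)); vm_compute.
- refine (fin (refl2 (sqrt2) V G) tau Pt2 (RR _ _ RV RG) _ _); first by vm_compute.
  by move=> su; refine (S1 _ _ _ (SR _ _ su SG)); vm_compute.
Qed.

Definition lattice_terms (l : seq (gold2Z * 'rV[gold2Z]_n)) :=
  forall p, p \in l -> p.1 \in lattice_scalars /\ subroot p.2.

Definition lattice_sum x := exists2 l, lattice_terms l & x = \sum_(p <- l) p.1 *: p.2.

Lemma lattice_sum0 : lattice_sum 0.
Proof. by exists [::]; rewrite ?big_nil. Qed.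

Lemma lattice_sumD x y : lattice_sum x -> lattice_sum y -> lattice_sum (x + y).
Proof.
move=> [l lP ->] [k kP ->]; exists (l ++ k); last by rewrite big_cat.
by move=> p; rewrite mem_cat => /orP[/lP|/kP].
Qed.

Lemma lattice_sum1 m g : m \in lattice_scalars -> subroot g -> lattice_sum (m *: g).
Proof.
move=> mP sg; exists [:: (m, g)]; last by rewrite big_seq1.
by move=> p; rewrite inE => /eqP->.
Qed.

(** A negative coefficient is absorbed by replacing [g] with the root [- g]. *)
Lemma lattice_sumZ m g (z : int) : m \in lattice_scalars -> subroot g ->
  lattice_sum ((z%:~R * m) *: g).
Proof.
move=> mP; wlog: z g / 0 <= z => [H sg|z0 sg].
  have [z0|z0] := leP 0 z; first exact: H.
  have := H (- z) (- g); rewrite mulrNz mulNr scaleNr scalerN opprK; apply; first by lia.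
  exact: subrootN.
rewrite -(gez0_abs z0); elim: `|z|%N => [|k IHk]; first by rewrite mul0r scale0r; apply: lattice_sum0.
by rewrite -pmulrn mulrS mulrDl mul1r scalerDl; apply: lattice_sumD (lattice_sum1 mP sg) IHk.
Qed.

Lemma gold2Z_expand (c : gold2Z) : c = c.1.1%:~R * 1 + c.1.2%:~R * tau +
  (c.2.1%:~R * sqrt2 + c.2.2%:~R * (sqrt2 * tau)).
Proof.
apply: emb_inj => d; case: c => [[p r] [q s]] /=.
rewrite !rmorphD !rmorphM !rmorph_int rmorph1 [emb d sqrt2]embed_sqrt2 [emb d tau]embed_tau.
by rewrite [LHS]embedE; ring.
Qed.

Lemma lattice_full x : (exists Q, Q *m P = 1%:M) -> lattice_sum x.
Proof.
case=> Q QP; rewrite -[x]mulmx1 -QP mulmxA mulmx_sum_row.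
apply: big_ind => [||i _]; [exact: lattice_sum0 | exact: lattice_sumD |].
have sub_i : subroot (row i P).
  by exists i, 1%g; rewrite group1 (rep1 repr) mulmx1.
rewrite [_ 0 i]gold2Z_expand !scalerDl.
by do !apply: lattice_sumD; apply: lattice_sumZ => //; rewrite !inE eqxx ?orbT.
Qed.

(* The coefficient of [1] is a linear form on Z[sqrt 2, tau] that is positive on
   the norms of [v] and [tau v], hence on the product with one of the terms. *)
Lemma short_vector_subroot v s eps l :
    root v s -> eps \in [:: 1; tau] -> lattice_terms l ->
    eps *: v = \sum_(p <- l) p.1 *: p.2 ->
  subroot v.
Proof.
have [N] := ubnP (size l); elim: N v s eps l => // N IH v s eps l szl rv epsP lP sum_l.
have vv := root_norm repr rv.
have norm_sum : \sum_(p <- l) (eps * p.1 * form B v p.2).1.1 = (eps * eps * 2).1.1.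
  rewrite -vv.
  have -> : eps * eps * form B v v = form B (eps *: v) (\sum_(p <- l) p.1 *: p.2).
    by rewrite -sum_l formZl (formZr (rep_sym repr)) mulrA.
  elim: (l) => [|p k IHk]; first by rewrite !big_nil /form trmx0 mulmx0 mxE.
  rewrite !big_cons IHk (formDr (rep_sym repr)) (formZr (rep_sym repr)).
  by rewrite [form _ (eps *: v) p.2]formZl [p.1 * _]mulrCA mulrA.
have [p pl pos] : exists2 p, p \in l & 0 < (eps * p.1 * form B v p.2).1.1.
  have [/hasP[p pl pos]|/hasPn neg] := boolP (has (fun p => 0 < (eps * p.1 * form B v p.2).1.1) l).
    by exists p.
  (* The sum is the coefficient of [1] in the norm of [eps *: v], that is in [2] or [2 + 2 tau]; it
     equals [2] in both cases. *)
  have : \sum_(p <- l) (eps * p.1 * form B v p.2).1.1 <= 0.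
    by rewrite big_seq; apply: sumr_le0 => p /neg; rewrite -leNgt.
  by rewrite norm_sum; move: epsP; rewrite !inE => /orP[] /eqP ->.
have [mP sg] := lP p pl.
have [->|[u [eps' [eps'P [r ru] def_u back]]]] := lattice_step epsP mP rv sg pos; first by [].
apply/back/(IH u r eps' (rem p l)) => //.
- by rewrite size_rem //; case: (l) pl szl => // q k _ /=; rewrite ltnS => /ltnW.
- by move=> q /mem_rem; apply: lP.
by rewrite -def_u sum_l (big_rem p pl) /= addrAC subrr add0r.
Qed.

Lemma lattice_roots v s : (exists Q, Q *m P = 1%:M) -> root v s -> subroot v.
Proof.
move=> QP rv; have [l lP def_v] := lattice_full v QP.
by apply: (short_vector_subroot (eps := 1) rv _ lP); rewrite ?mem_head ?scale1r.
Qed.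

End Lattice.

Lemma roots_generate (P : 'M[gold2Z]_n) (t : 'I_n -> gT) : root_rows W e rho P t ->
  (exists Q, Q *m P = 1%:M) -> W :=: <<[set t i | i in 'I_n]>>%g.
Proof.
move=> Pt QP; apply/eqP; rewrite eqEsubset; apply/andP; split; last first.
  by apply/subsetP => x; exact: (W'_sub Pt).
rewrite (cox_gen coxWS) gen_subG; apply/subsetP => _ /imsetP[i _ ->].
have [s rs sW'] := subroot_root Pt (lattice_roots Pt QP (root_e repr i)).
by rewrite (gold_root_inj (root_e repr i) rs).
Qed.

(** The argument over the reals only puts twice a simple root in the span of the rows, and [2] is
    not a unit here. Instead, each simple root is up to sign the image of a row under an element of
    [W], which is the identity modulo the rows. *)
Lemma generating_roots_inv (P : 'M[gold2Z]_n) (t : 'I_n -> gT) : root_rows W e rho P t ->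
  W :=: <<[set t i | i in 'I_n]>>%g -> exists Q, Q *m P = 1%:M.
Proof.
move=> Pt defW; have tT : [set t i | i in 'I_n] \subset reflections W [set e i | i in 'I_n].
  by apply/subsetP => _ /imsetP[i _ ->]; apply: root_T (Pt i).
have row_i i : exists q : 'rV_n, q *m P = delta_mx 0 i.
  have [u [g [/imsetP[j _ ->] gW def_e]]] := simple_conj_generator coxWS tT defW (S_e e i).
  have rj := rootJ repr gW (Pt j); rewrite -def_e in rj.
  have [|Z defZ] := root_rows_span repr Pt (x := g); first by rewrite -defW.
  have rowZ : row j P *m rho g = (delta_mx 0 j + row j P *m Z) *m P.
    by rewrite defZ mulmxDr mulmx1 mulmxDl -rowE mulmxA.
  have [-> | ->] := root_unique (root_e repr i) rj; first by exists (delta_mx 0 j + row j P *m Z).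
  by exists (- (delta_mx 0 j + row j P *m Z)); rewrite mulNmx rowZ.
have [q qP] := fin_all_exists row_i; exists (\matrix_i q i).
by apply/row_matrixP => i; rewrite row_mul rowK qP rowE mulmx1.
Qed.

Lemma small_generation (t t' : 'I_n -> gT) :
    (forall i, t i \in reflections W [set e i | i in 'I_n]) ->
    (forall i, t' i \in reflections W [set e i | i in 'I_n]) ->
    (\prod_(i < n) t i = \prod_(i < n) t' i)%g ->
  W :=: <<[set t i | i in 'I_n]>>%g -> W :=: <<[set t' i | i in 'I_n]>>%g.
Proof.
move=> tT t'T eq_prod defW.
have [P Pt] := root_rows_exist rho tT; have [P' Pt'] := root_rows_exist rho t'T.
have [Q QP] := generating_roots_inv Pt defW.
have detP : \det P' ^+ 2 = \det P ^+ 2.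
  by apply: gold_det_regular; rewrite -(root_rows_det repr Pt) -(root_rows_det repr Pt') eq_prod.
(* The inverse of [\det P'] is [\det P' * \det Q ^+ 2], because [\det P' ^+ 2 = \det P ^+ 2] and
   [Q *m P = 1]. *)
apply: (roots_generate Pt'); exists ((\det P' * \det Q ^+ 2) *: \adj P').
rewrite -scalemxAl mul_adj_mx scale_scalar_mx mulrAC -expr2 detP -exprMn.
by rewrite [\det P * _]mulrC -det_mulmx QP det1 expr1n.
Qed.

End SmallOrders.

(** * Systems with an order at least 6 *)

Section Cosines.
Local Notation R := Rdefinitions.R.
Local Notation cos := Rtrigo_def.cos.
Local Notation sin := Rtrigo_def.sin.
Local Notation pi := Rtrigo1.PI.

Lemma sinB_D (x y : R) : sin (x + y) + sin (x - y) = 2 * cos y * sin x.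
Proof.
have sD (u v : R) : sin (u + v) = sin u * cos v + cos u * sin v := Rtrigo1.sin_plus u v.
have sN (u : R) : sin (- u) = - sin u := Rtrigo1.sin_neg u.
have cN (u : R) : cos (- u) = cos u := Rtrigo1.cos_neg u.
by rewrite !sD sN cN; ring.
Qed.

Lemma cheb_sin (x : R) k : cheb (2 * cos x) k * sin x = sin (k%:R * x).
Proof.
have [m] := ubnP k; elim: m k => // m IH [|[|k]] km.
- by rewrite mul0r mul0r; apply/esym/Rtrigo_def.sin_0.
- by rewrite !mul1r.
rewrite chebSS mulrBl -mulrA !IH; [|lia|lia].
have := sinB_D (k.+1%:R * x) x.
have -> : k.+1%:R * x + x = k.+2%:R * x by rewrite -[k.+2]addn1 natrD mulrDl mul1r.
have -> : k.+1%:R * x - x = k%:R * x by rewrite -addn1 natrD mulrDl mul1r addrK.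
lra.
Qed.

Lemma pi_gt0 : 0 < pi. Proof. exact/RltP/Rtrigo1.PI_RGT_0. Qed.

Lemma cos_le (x y : R) : 0 <= x -> x <= y -> y <= pi -> cos y <= cos x.
Proof.
move=> x0 xy ypi; apply/RleP/Rtrigo1.cos_decr_1; apply/RleP => //.
- exact: le_trans ypi.
- exact: le_trans xy.
Qed.

Lemma cos_pi3 : cos (pi / 3) = 1 / 2.
Proof.
by have := Rtrigo_calc.cos_PI3; rewrite !RealsE.
Qed.

(** Since [c ^+ 2 - 2] is [2 cos (2 pi / m)], [cheb_sin] reduces the Chebyshev values to the sines
    of [2 pi] and [2 pi - 2 pi / m]. The last bound comes from [2 pi / m <= pi / 3]. *)
Lemma cosine_spec m : (3 <= m)%N -> let c : R := 2 * cos (pi / m%:R) in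
  [/\ 1 <= c, c ^+ 2 < 4, cheb (c ^+ 2 - 2) m = 0, cheb (c ^+ 2 - 2) m.-1 = - 1 &
      (6 <= m)%N -> 3 <= c ^+ 2].
Proof.
move=> m3; set th : R := pi / m%:R.
have pi0 := pi_gt0.
have m0 : m%:R != 0 :> R by rewrite pnatr_eq0; lia.
have th_le k : (0 < k <= m)%N -> th <= pi / k%:R.
  move=> /andP[k0 km]; rewrite /th ler_pM2l // lef_pV2 ?posrE ?ltr0n ?ler_nat //; lia.
have th3 : th <= pi / 3 by apply: (th_le 3); lia.
have th0 : 0 < th by rewrite divr_gt0 // ltr0n; lia.
have c2 : (2 * cos th) ^+ 2 - 2 = 2 * cos (2 * th).
  have : cos (th + th) = cos th * cos th - sin th * sin th := Cos_plus.cos_plus th th.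
  have : sin th * sin th + cos th * cos th = 1 := Rtrigo1.sin2_cos2 th.
  have -> : 2 * th = th + th by ring.
  move=> h ->; have -> : sin th * sin th = 1 - cos th * cos th by rewrite -h; ring.
  ring.
have sin_gt0 (x : R) : 0 < x -> x < pi -> 0 < sin x.
  by move=> x0 xpi; apply/RltP/Rtrigo1.sin_gt_0; apply/RltP.
have s2 : 0 < sin (2 * th) by apply: sin_gt0; lra.
have cos_th : 1 / 2 <= cos th by rewrite -cos_pi3; apply: cos_le; lra.
have sin_th : 0 < sin th by apply: sin_gt0; lra.
have sc : sin th * sin th + cos th * cos th = 1 := Rtrigo1.sin2_cos2 th.
have mth : m%:R * (2 * th) = 2 * pi by rewrite /th; field.
split.
- lra.
- by rewrite exprMn; have := mulr_gt0 sin_th sin_th; nra.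
- apply: (mulIf (lt0r_neq0 s2)); rewrite c2 cheb_sin mul0r mth.
  exact: Rtrigo1.sin_2PI.
- apply: (mulIf (lt0r_neq0 s2)); rewrite c2 cheb_sin.
  have -> : m.-1%:R * (2 * th) = - (2 * th) + 2 * pi.
    by rewrite -mth -[in RHS](prednK (n := m)) ?natrS; [ring|lia].
  have -> : sin (- (2 * th) + 2 * pi) = sin (- (2 * th)).
    have sD (u v : R) : sin (u + v) = sin u * cos v + cos u * sin v := Rtrigo1.sin_plus u v.
    have c2pi : cos (2 * pi) = 1 := Rtrigo1.cos_2PI.
    have s2pi : sin (2 * pi) = 0 := Rtrigo1.sin_2PI.
    by rewrite sD c2pi s2pi mulr1 mulr0 addr0.
  have -> : sin (- (2 * th)) = - sin (2 * th) := Rtrigo1.sin_neg _.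
  by rewrite mulN1r.
move=> m6; have : cos (pi / 3) <= cos (2 * th).
  have th6 : th <= pi / 6 by apply: (th_le 6); lia.
  by apply: cos_le; lra.
by rewrite cos_pi3; move: c2; lra.
Qed.

End Cosines.

Local Close Scope ring_scope.
Local Open Scope group_scope.

Lemma real_geomrep_exists (gT : finGroupType) (W : {group gT}) n (e : 'I_n -> gT) :
    coxeter_system W [set e i | i in 'I_n] -> injective e ->
  exists (B : 'M[Rdefinitions.R]_n) rho, [/\ geomrep W e B rho,
    forall i j, i != j -> (B i j <= 0)%R,
    forall i j, (3 <= #[e i * e j]%g)%N -> (B i j <= - 1)%R &
    forall i j, (6 <= #[e i * e j]%g)%N -> (3 <= B i j ^+ 2)%R].
Proof.
(* The default [0] is the cosine value for order 2; order 1 occurs only on the diagonal, where [B]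
   has [2]. *)
move=> coxWS e_inj; pose c m : Rdefinitions.R :=
  (if (3 <= m)%N then 2 * Rtrigo_def.cos (Rtrigo1.PI / m%:R) else 0)%R.
pose B : 'M[Rdefinitions.R]_n := (\matrix_(i, j) if i == j then 2 else - c #[e i * e j]%g)%R.
have ee i : (e i * e i = 1)%g by apply: (cox_inv coxWS); apply: imset_f.
have oii i : #[e i * e i]%g = 1%N by rewrite ee order1.
have [|rho repr] := geomrep_exists (B := B) coxWS e_inj.
  split.
  - by apply/matrixP => i j; rewrite !mxE eq_sym (order_sym coxWS).
  - by move=> i; rewrite mxE eqxx.
  move=> i j ij /=; rewrite mxE (negPf ij) sqrrN.
  have := order_gt1 coxWS e_inj ij; rewrite leq_eqVlt => /orP[/eqP <-|m3].
    by left; rewrite /c /= oppr0.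
  have [c1 c4 ch0 ch1 _] := cosine_spec m3; rewrite /c m3; right; split=> // a.
  by move/eqP; rewrite mulf_eq0 gt_eqF ?subr_gt0 //= => /eqP.
exists B, rho; split=> // [i j ij|i j m3|i j m6].
- rewrite mxE (negPf ij) oppr_le0 /c; case: ifP => // m3.
  by have [c1 _ _ _ _] := cosine_spec m3; apply: le_trans c1.
- rewrite mxE; case: eqP m3 => [->|_ m3]; first by rewrite oii.
  by rewrite lerN2 /c m3; have [] := cosine_spec m3.
have m3 : (3 <= #[e i * e j]%g)%N by apply: leq_trans m6.
rewrite mxE; case: eqP m6 => [->|_ m6]; first by rewrite oii.
by rewrite sqrrN /c m3; have [_ _ _ _ ->] := cosine_spec m3.
Qed.

Lemma seq_family (gT : finGroupType) (t : seq gT) k : size t = k ->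
  exists f : 'I_k -> gT, [/\ forall i, f i \in t, \prod_(x <- t) x = \prod_(i < k) f i &
    [set x in t] = [set f i | i in 'I_k]].
Proof.
move=> <-; exists (tnth (in_tuple t)); split=> [i||]; first exact: mem_tnth.
  by rewrite big_tnth.
apply/setP => x; rewrite inE; apply/idP/imsetP => [xt|[i _ ->]]; last exact: mem_tnth.
by have /tnthP[i ->] : x \in in_tuple t by []; exists i.
Qed.

Lemma enum_simple (gT : finGroupType) (S : {set gT}) :
  [set enum_val i | i in 'I_#|S|] = S.
Proof.
apply/setP => x; apply/imsetP/idP => [[i _ ->]|xS]; first exact: enum_valP.
by exists (enum_rank_in xS x); rewrite ?enum_rankK_in.
Qed.

(** Stated with sequences, so that a factorization can be filtered into its parts when [W]
    splits. *)
Definition generation_rigid (gT : finGroupType) (W : {group gT}) (S : {set gT}) :=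
  forall t t' : seq gT, size t = #|S| -> size t' = #|S| ->
    {subset t <= reflections W S} -> {subset t' <= reflections W S} ->
    \prod_(x <- t) x = \prod_(x <- t') x ->
  W :=: <<[set x in t]>> -> W :=: <<[set x in t']>>.

(** * Rank bounds, and rigidity for small orders and for rank 2 *)

Section SystemRank.
Variables (gT : finGroupType) (W : {group gT}) (S : {set gT}).
Hypothesis coxWS : coxeter_system W S.
Let T := reflections W S.

Let e (i : 'I_#|S|) : gT := enum_val i.
Let e_inj : injective e. Proof. exact: enum_val_inj. Qed.
Let defS : [set e i | i in 'I_#|S|] = S. Proof. exact: enum_simple. Qed.
Let coxWe : coxeter_system W [set e i | i in 'I_#|S|]. Proof. by rewrite defS. Qed.

Lemma generating_size_ge (t : seq gT) : {subset t <= T} -> W :=: <<[set x in t]>> ->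
  #|S| <= size t.
Proof.
move=> tT; have [f [ft _ ->]] := seq_family (erefl (size t)).
have [B [rho [repr _ _ _]]] := real_geomrep_exists coxWe e_inj.
by apply: (generating_size repr) => i; rewrite defS; apply/tT/ft.
Qed.

Lemma factorization_size_ge (t t' : seq gT) : size t = #|S| ->
    {subset t <= T} -> {subset t' <= T} -> \prod_(x <- t) x = \prod_(x <- t') x ->
  W :=: <<[set x in t]>> -> #|S| <= size t'.
Proof.
move=> szt tT t'T; have [f [ft -> ->]] := seq_family szt.
have [f' [ft' -> _]] := seq_family (erefl (size t')) => eq_prod defW.
have [B [rho [repr _ _ _]]] := real_geomrep_exists coxWe e_inj.
by apply: (quasi_coxeter_size repr _ _ defW eq_prod) => i; rewrite defS; [apply/tT | apply/t'T].
Qed.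

Lemma heavy_pair_commutes s s' u : s \in S -> s' \in S -> u \in S :\: [set s; s'] ->
  6 <= #[s * s'] -> s * u = u * s.
Proof.
move=> sS s'S; rewrite !inE negb_or => /andP[/andP[us us'] uS] m6.
have [B [rho [repr Bneg B3 B6]]] := real_geomrep_exists coxWe e_inj.
have index x : x \in S -> exists i, x = e i.
  by move=> xS; exists (enum_rank_in xS x); rewrite /e enum_rankK_in.
have [i def_s] := index s sS; have [j def_s'] := index s' s'S; have [k def_u] := index u uS.
have inv := cox_inv coxWS.
have ij : i != j.
  by apply: contraTneq m6 => eq_ij; rewrite def_s def_s' eq_ij -def_s' inv // order1.
have ik : i != k by apply: contraNneq us => eq_ik; rewrite def_s def_u eq_ik.
have jk : j != k by apply: contraNneq us' => eq_jk; rewrite def_s' def_u eq_jk.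
have light : #[s * u] <= 2.
  rewrite leqNgt; apply/negP; rewrite def_s def_u => /B3; apply/negP; rewrite -ltNge.
  by apply: (heavy_edge_isolated repr) ij ik jk _ => //; apply: B6; rewrite -def_s -def_s'.
have su1 : s * u != 1.
  apply: contra ik => /eqP su1; apply/eqP/e_inj; rewrite -def_s -def_u.
  by rewrite -(mulg1_eq su1) (mulg1_eq (inv s sS)).
have o2 : #[s * u] = 2.
  by apply/eqP; rewrite eqn_leq light ltn_neqAle order_gt0 eq_sym order_eq1 su1.
have : (s * u) * (s * u) = 1 by rewrite -expg2 -o2 expg_order.
move/mulg1_eq; rewrite invMg (mulg1_eq (inv s sS)) (mulg1_eq (inv u uS)).
by move->.
Qed.

Lemma small_rigid : (forall s s', s \in S -> s' \in S -> #[s * s'] <= 5) -> generation_rigid W S.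
Proof.
move=> small t t' szt szt' tT t'T.
have [f [ft -> ->]] := seq_family szt; have [f' [ft' -> ->]] := seq_family szt'.
have small_e i j : #[e i * e j] <= 5 by apply: small; rewrite -defS imset_f.
have [rho repr] := geomrep_exists coxWe e_inj
  (gold_coxeter_form coxWe e_inj small_e Rdefinitions.R).
apply: (small_generation coxWe e_inj small_e Rdefinitions.R repr) => i; rewrite defS.
  exact/tT.
exact/t'T.
Qed.

Lemma rank2_rigid : #|S| = 2 -> generation_rigid W S.
Proof.
move=> S2 t t'; rewrite S2.
case: t => [|t1 [|t2 []]] // _; case: t' => [|t3 [|t4 []]] // _ tT t'T.
rewrite !big_cons !big_nil !mulg1 => eq_prod.
have setE (x y : gT) : [set z in [:: x; y]] = [set x; y] by apply/setP => z; rewrite !inE.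
rewrite !setE => defW; apply: (dihedral_generation coxWS _ defW eq_prod).
apply/subsetP => x; rewrite !inE -!orbA => /or4P[] /eqP ->;
  first [by apply: tT; rewrite !inE eqxx ?orbT | by apply: t'T; rewrite !inE eqxx ?orbT].
Qed.

End SystemRank.

(** * Splitting along a set of simple reflections that commute with the others *)

Section CommutingPart.
Variables (gT : finGroupType) (W : {group gT}) (S C : {set gT}).
Hypotheses (coxWS : coxeter_system W S) (CS : C \subset S).
Hypothesis commCD : forall s u, s \in C -> u \in S :\: C -> s * u = u * s.

Let D := S :\: C.
Let CSs s : s \in C -> s \in S. Proof. exact/subsetP. Qed.
Let inv := cox_inv coxWS.

(** The extension of [f] by [1] on [D] respects the relations between [C] and [D], where the orders
    are 2 and each [f s] has square [1]. *)
Lemma part_hom (G : groupType) (f : gT -> G) :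
    (forall s s', s \in C -> s' \in C -> (f s * f s') ^+ #[s * s'] = 1) ->
  exists g : gT -> G, [/\ forall x y, x \in W -> y \in W -> g (x * y) = g x * g y,
    forall s, s \in C -> g s = f s, forall s, s \in D -> g s = 1 & g 1 = 1].
Proof.
move=> fM; pose f' s := if s \in C then f s else 1.
have ff s : s \in C -> f s * f s = 1.
  by move=> sC; have := fM s s sC sC; rewrite inv ?CSs // order1 expg1.
have order2 s u : s \in C -> u \in S -> u \notin C -> #[s * u] = 2.
  move=> sC uS uC; have uD : u \in D by rewrite inE uC.
  apply/prime_nt_dvdP => //; last first.
    rewrite order_dvdn expg2 {2}(commCD sC uD) mulgA -(mulgA s) inv // mulg1 inv //.
    exact: CSs.
  rewrite order_eq1; apply: contraNneq uC => /mulg1_eq.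
  by rewrite (mulg1_eq (inv (CSs sC))) => <-.
have [|g [gM gS g1]] := @cox_hom _ _ _ coxWS _ f'.
  move=> s s' sS s'S; rewrite /f'; case: ifPn => sC; case: ifPn => s'C.
  - exact: fM.
  - by rewrite mulg1 order2 // expg2 ff.
  - have [s'D sD] : s' \in C /\ s \in D by rewrite inE sC.
    by rewrite mul1g -(commCD s'D sD) order2 // expg2 ff.
  by rewrite mulg1 expg1n.
exists g; split=> // s => [sC|]; first by rewrite gS ?CSs // /f' sC.
by rewrite inE => /andP[sC sS]; rewrite gS // /f' (negPf sC).
Qed.

Lemma part_system : coxeter_system <<C>>%G C.
Proof.
have CW : <<C>> \subset W by rewrite gen_subG (subset_trans CS) ?(cox_sub coxWS).
case: (coxWS) => _ o2 _; split=> // [s /CSs/o2 //|G f /part_hom[g [gM gC _ _]]].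
by exists g; split=> // x y /(subsetP CW) xW /(subsetP CW); apply: gM.
Qed.

Lemma part_projection : exists pi : gT -> gT,
  [/\ forall x y, x \in W -> y \in W -> pi (x * y) = pi x * pi y,
      forall x, x \in <<C>> -> pi x = x, forall x, x \in <<D>> -> pi x = 1 & pi 1 = 1].
Proof.
have [|g [gM gC gD g1]] := @part_hom _ id; first by move=> s s' _ _; apply: expg_order.
have genW (A : {set gT}) : A \subset S -> <<A>> \subset W.
  by move=> AS; rewrite gen_subG (subset_trans AS) ?(cox_sub coxWS).
have CW := subsetP (genW C CS); have DW := subsetP (genW D (subsetDl S C)).
exists g; split=> //.
  apply: gen_ind => // s x sC xC gx.
  by rewrite (gM _ _ (CW _ (mem_gen sC)) (CW _ xC)) gC // gx.
apply: gen_ind => // s x sD xD gx.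
by rewrite (gM _ _ (DW _ (mem_gen sD)) (DW _ xD)) gD // gx mulg1.
Qed.

(** Conjugation by a letter of [C] stays inside [<<C>>], and the other simple reflections centralize
    [<<C>>]. *)
Lemma part_conj t x : t \in reflections <<C>> C -> x \in W -> t ^ x \in reflections <<C>> C.
Proof.
move=> tC xW; move: x xW t tC; apply: (subset_gen_ind (cox_gen coxWS)) => [t|s x sS _ IHx t tC].
  by rewrite conjg1.
rewrite conjgM; apply: IHx; have [sC|sC] := boolP (s \in C).
  have /reflectionsP[w [r [wC rC ->]]] := tC; apply/reflectionsP; exists (w * s), r.
  by split; rewrite ?conjgM // groupM // mem_gen.
suff cst : t * s = s * t by rewrite conjgE cst mulKg.
have tgen : t \in <<C>>.
  by apply: (subsetP (reflections_sub (W := <<C>>%G) (subset_gen C))).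
have /centP cs : s \in 'C(<<C>>).
  by rewrite cent_gen; apply/centP => r rC; apply/esym/commCD; rewrite // inE sC.
exact/esym/cs.
Qed.

End CommutingPart.

Section Splitting.
Variables (gT : finGroupType) (W : {group gT}) (S C : {set gT}).
Hypotheses (coxWS : coxeter_system W S) (CS : C \subset S).
Hypothesis commCD : forall s u, s \in C -> u \in S :\: C -> s * u = u * s.

Let D := S :\: C.
Let DS : D \subset S. Proof. exact: subsetDl. Qed.
Let DDC : S :\: D = C. Proof. by rewrite setDDr setDv set0U; apply/setIidPr. Qed.
Let commDC s u : s \in D -> u \in S :\: D -> s * u = u * s.
Proof. by rewrite DDC => sD uC; apply/esym/commCD. Qed.

Let TC := reflections <<C>> C.
Let TD := reflections <<D>> D.
Let coxC : coxeter_system <<C>>%G C := part_system coxWS CS commCD.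
Let coxD : coxeter_system <<D>>%G D := part_system coxWS DS commDC.

Lemma reflections_split t : t \in reflections W S -> (t \in TC) || (t \in TD).
Proof.
case/reflectionsP=> w [s [wW sS ->]].
have self (A : {set gT}) r : r \in A -> r \in reflections <<A>> A.
  by move=> rA; apply/reflectionsP; exists 1, r; rewrite conjg1 group1.
have [sC|sC] := boolP (s \in C).
  by apply/orP; left; apply: (part_conj coxWS commCD (self C s sC) wW).
have sD : s \in D by rewrite inE sC.
by apply/orP; right; apply: (part_conj coxWS commDC (self D s sD) wW).
Qed.

Section Projection.
Variable pi : gT -> gT.
Hypotheses (piM : forall x y, x \in W -> y \in W -> pi (x * y) = pi x * pi y)
  (piC : forall x, x \in <<C>> -> pi x = x) (piD : forall x, x \in <<D>> -> pi x = 1)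
  (pi1 : pi 1 = 1).

(** The projection both fixes and kills a common element, which is then [1], although reflections
    have order 2. *)
Lemma reflections_disjoint t : t \in TC -> t \notin TD.
Proof.
move=> tC; apply/negP => tD; have := refl_mem coxC tC; have := refl_mem coxD tD.
move=> /piD pt1 /piC; rewrite pt1; have [w [s [_ sC ->]]] := reflectionsP _ _ _ tC.
move/esym/eqP; rewrite conjg_eq1 => /eqP s1.
by case: (coxC) => _ /(_ s sC); rewrite s1 order1.
Qed.

Lemma size_split (t : seq gT) : {subset t <= reflections W S} ->
  size [seq x <- t | x \in TC] + size [seq x <- t | x \in TD] = size t.
Proof.
move=> tT; rewrite !size_filter -(count_predC (mem TC) t); congr (_ + _).
apply: eq_in_count => x /tT/reflections_split /= /orP[xC|xD].
  by rewrite xC; apply/negP/negP/reflections_disjoint.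
by rewrite xD; apply/esym; apply: contraL xD; apply: reflections_disjoint.
Qed.

Lemma prod_split (t : seq gT) : {subset t <= reflections W S} ->
  pi (\prod_(x <- t) x) = \prod_(x <- [seq x <- t | x \in TC]) x.
Proof.
elim: t => [|x t IHt] tT; first by rewrite !big_nil.
have tT' : {subset t <= reflections W S} by move=> y yt; apply: tT; rewrite inE yt orbT.
have xT : x \in reflections W S by apply: tT; rewrite mem_head.
have tW : \prod_(y <- t) y \in W.
  by rewrite big_seq group_prod // => y /tT'; exact: (refl_mem coxWS).
rewrite big_cons piM ?(refl_mem coxWS xT) // IHt // /=; case: ifP => [xC|xC].
  by rewrite big_cons piC // (refl_mem coxC xC).
have := reflections_split xT; rewrite xC /= => /(refl_mem coxD)/piD ->.
by rewrite mul1g.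
Qed.

(** The projection fixes the terms in [TC] and sends the others to [1], so the former generate its
    image [<<C>>]. *)
Lemma gen_split (t : seq gT) : {subset t <= reflections W S} -> W :=: <<[set x in t]>> ->
  <<C>> = <<[set x in [seq x <- t | x \in TC]]>>.
Proof.
move=> tT defW; set A := [set x in [seq _ <- _ | _]].
have sCW s : s \in C -> s \in W by move=> sC; exact: (cox_mem coxWS (subsetP CS s sC)).
have piA x : x \in W -> pi x \in <<A>>.
  move: x; apply: (subset_gen_ind defW) => [|a x]; first by rewrite pi1.
  rewrite inE => at_ xW pix; have aT := tT a at_.
  rewrite piM ?(refl_mem coxWS aT) // groupM //; have := reflections_split aT.
  case/orP=> [aC|aD]; last by rewrite piD ?(refl_mem coxD aD).
  by rewrite piC ?(refl_mem coxC aC) // mem_gen // inE mem_filter aC.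
apply/eqP; rewrite eqEsubset !gen_subG; apply/andP; split; apply/subsetP => x.
  by move=> xC; have := piA x (sCW x xC); rewrite (piC (mem_gen xC)).
by rewrite inE mem_filter => /andP[/(refl_mem coxC)].
Qed.

End Projection.
End Splitting.

Lemma rigid_split (gT : finGroupType) (W : {group gT}) (S C : {set gT}) :
    coxeter_system W S -> C \subset S ->
    (forall s u, s \in C -> u \in S :\: C -> s * u = u * s) ->
    generation_rigid <<C>>%G C -> generation_rigid <<S :\: C>>%G (S :\: C) ->
  generation_rigid W S.
Proof.
move=> coxWS CS commCD rigC rigD t t' szt szt' tT t'T eq_prod defW.
set D := S :\: C in commCD rigD.
have DS : D \subset S := subsetDl _ _.
have DDC : S :\: D = C by rewrite setDDr setDv set0U; apply/setIidPr.
have commDC s u : s \in D -> u \in S :\: D -> s * u = u * s.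
  by rewrite DDC => sD uC; apply/esym/commCD.
have coxC := part_system coxWS CS commCD; have coxD := part_system coxWS DS commDC.
have [piC [pM pC pD p1]] := part_projection coxWS CS commCD.
have [piD [qM qD qC q1]] := part_projection coxWS DS commDC.
rewrite DDC in qC.
pose tc (u : seq gT) := [seq x <- u | x \in reflections <<C>> C].
pose td (u : seq gT) := [seq x <- u | x \in reflections <<D>> D].
have tcT u : {subset tc u <= reflections <<C>> C} by move=> x; rewrite mem_filter => /andP[].
have tdT u : {subset td u <= reflections <<D>> D} by move=> x; rewrite mem_filter => /andP[].
have sz_split u : {subset u <= reflections W S} -> size (tc u) + size (td u) = size u.
  exact: (size_split coxWS CS commCD pC pD).
have genC : <<C>> = <<[set x in tc t]>> := gen_split coxWS CS commCD pM pC pD p1 tT defW.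
have genD : <<D>> = <<[set x in td t]>>.
  by apply: (gen_split coxWS DS commDC qM qD _ q1 tT defW); rewrite DDC.
have prodC : \prod_(x <- tc t) x = \prod_(x <- tc t') x.
  by rewrite -!(prod_split coxWS CS commCD pM pC pD p1) // eq_prod.
have prodD : \prod_(x <- td t) x = \prod_(x <- td t') x.
  by rewrite -!(prod_split coxWS DS commDC qM qD _ q1) ?DDC // eq_prod.
have cardS : #|C| + #|D| = #|S| by rewrite -(cardsID C S) (setIidPr CS).
have geC : #|C| <= size (tc t) := generating_size_ge coxC (tcT t) genC.
have geD : #|D| <= size (td t) := generating_size_ge coxD (tdT t) genD.
(* The parts of [t] have at least [#|C|] and [#|D|] terms and together exactly [#|C| + #|D|], so
   both bounds are equalities; the same count then applies to [t']. *)
have [szC szD] : size (tc t) = #|C| /\ size (td t) = #|D|.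
  by have := sz_split t tT; rewrite szt -cardS; lia.
have geC' : #|C| <= size (tc t') := factorization_size_ge coxC szC (tcT t) (tcT t') prodC genC.
have geD' : #|D| <= size (td t') := factorization_size_ge coxD szD (tdT t) (tdT t') prodD genD.
have [szC' szD'] : size (tc t') = #|C| /\ size (td t') = #|D|.
  by have := sz_split t' t'T; rewrite szt' -cardS; lia.
have genC' := rigC _ _ szC szC' (tcT t) (tcT t') prodC genC.
have genD' := rigD _ _ szD szD' (tdT t) (tdT t') prodD genD.
apply/eqP; rewrite eqEsubset; apply/andP; split; last first.
  by rewrite gen_subG; apply/subsetP => x; rewrite inE => /t'T; exact: (refl_mem coxWS).
have sub (f : seq gT -> seq gT) : {subset f t' <= t'} -> <<[set x in f t']>> \subset <<[set x in t']>>.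
  by move=> ft; apply: genS; apply/subsetP => x; rewrite !inE; apply: ft.
rewrite (cox_gen coxWS) gen_subG; apply/subsetP => s sS.
have [sC|sC] := boolP (s \in C).
  apply: (subsetP (sub tc _)) => [x|]; first by rewrite mem_filter => /andP[].
  by rewrite -genC' mem_gen.
apply: (subsetP (sub td _)) => [x|]; first by rewrite mem_filter => /andP[].
by rewrite -genD' mem_gen // inE sC.
Qed.

(** Induction on the rank: pairs with order at least 6 are split off one at a time until all orders
    are at most 5. *)
Lemma coxeter_rigid (gT : finGroupType) (W : {group gT}) (S : {set gT}) :
  coxeter_system W S -> generation_rigid W S.
Proof.
have [n] := ubnP #|S|; elim: n W S => // n IH W S ltSn coxWS.
have inv := cox_inv coxWS.
have [/existsP[s /existsP[s' /and3P[sS s'S m6]]]|none] :=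
    boolP [exists s, exists s', [&& s \in S, s' \in S & 6 <= #[s * s']]]; last first.
  apply: small_rigid => // s s' sS s'S; rewrite leqNgt; apply: contra none => m6.
  by apply/existsP; exists s; apply/existsP; exists s'; rewrite sS s'S.
have ss' : s != s' by apply: contraTneq m6 => ->; rewrite inv // order1.
have m6' : 6 <= #[s' * s].
  by rewrite -orderV invMg (mulg1_eq (inv _ sS)) (mulg1_eq (inv _ s'S)).
have CS : [set s; s'] \subset S by apply/subsetP => x; rewrite !inE => /orP[] /eqP->.
have comm r u : r \in [set s; s'] -> u \in S :\: [set s; s'] -> r * u = u * r.
  rewrite inE => /orP[] /set1P-> uD; first exact: (heavy_pair_commutes coxWS sS s'S).
  by apply: (heavy_pair_commutes coxWS s'S sS) => //; rewrite setUC.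
apply: (rigid_split coxWS CS comm).
  by apply: rank2_rigid; [exact: (part_system coxWS CS comm) | rewrite cards2 ss'].
apply: IH; last first.
  apply: (part_system coxWS (subsetDl _ _)) => r u rD; rewrite setDDr setDv set0U => /setIP[_ uC].
  by apply/esym/comm.
rewrite ltnS in ltSn; apply: leq_trans ltSn; apply: proper_card.
by rewrite properE subsetDl; apply/subsetPn; exists s; rewrite // !inE eqxx.
Qed.

Unset Implicit Arguments.

Theorem theorem1p2 (gT : finGroupType) (n : nat) (W : {group gT})
    (T : {set gT}) (w : gT)
    (dualWT : dual_coxeter_system n W T)
    (wW : w \in W)
    (qcw : quasi_coxeter n W T w) :
  forall t : n.-tuple gT, Red T w t -> W = <<[set x in t]>> :> {set gT}.
Proof.
move=> t' [[t'T prod_t'] _].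
case: dualWT => _ [S [_ cardS coxWS defT]].
case: qcw => t [[[tT prod_t] _] defW].
have sub (u : n.-tuple gT) : (forall i, tnth u i \in T) -> {subset u <= reflections W S}.
  by move=> uT x /tnthP[i ->]; rewrite /reflections -defT.
apply: (coxeter_rigid coxWS (t := t)) => //; rewrite ?size_tuple //; try exact: sub.
by rewrite !big_tuple prod_t prod_t'.
Qed.
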